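(* Let $L$ be a signature consisting of countably many relation symbols $(R_i)_i$ of arities $r_i\in\mathbb{N}\cup\{\mathbb{N}\}$, and let $\mathcal{H}$ be a Borel $L$-structure on a Polish space $Z$. Assume that there exist a Borel $L$-structure $\mathcal{G}$ on $[\mathbb{N}]^\mathbb{N}$ that does not admit a Borel homomorphism to $\mathcal{H}$, and a Borel map $\Phi:\mathcal{D}\to Z$, where $\mathcal{D}=\{(x,y)\in([\mathbb{N}]^\mathbb{N})^2: y\leq^\infty x\}$, such that for each $x\in[\mathbb{N}]^\mathbb{N}$ the map $\Phi_x:\mathcal{D}_x\to Z$, $\Phi_x(y)=\Phi(x,y)$, is a homomorphism from $\mathcal{G}\restriction\mathcal{D}_x$ to $\mathcal{H}$, where $\mathcal{D}_x=\{y: y\leq^\infty x\}$. Then the (codes of) Borel $L$-structures which admit a Borel homomorphism to $\mathcal{H}$ form a $\mathbf{\Sigma}^1_2$-complete set. In fact, already the restrictions of $\mathcal{G}'$ to Borel sets that admit a Borel homomorphism to $\mathcal{H}$ form a $\mathbf{\Sigma}^1_2$-complete set: the set of Borel codes $c\in\mathbf{BC}(\mathbb{N}^\mathbb{N}\times[\mathbb{N}]^\mathbb{N})$ such that $\mathcal{G}'\restriction \mathbf{A}(\mathbb{N}^\mathbb{N}\times[\mathbb{N}]^\mathbb{N})_c$ admits a Borel homomorphism to $\mathcal{H}$ is $\mathbf{\Sigma}^1_2$-complete.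
   Context: $[\mathbb{N}]^\mathbb{N}$ is the set of infinite subsets of $\mathbb{N}$, identified with their increasing enumerations; $y\leq^\infty x$ means $\{n:y(n)\leq x(n)\}$ is infinite. A Borel $L$-structure $\mathcal{G}$ on a Polish space $X$ is a family of Borel sets $R_i^{\mathcal{G}}\subseteq X^{r_i}$; its restriction $\mathcal{G}\restriction B$ to a Borel $B\subseteq X$ is the structure on $B$ with relations $B^{r_i}\cap R_i^{\mathcal{G}}$. A Borel homomorphism from $\mathcal{G}$ on $X$ to $\mathcal{H}$ on $Z$ is a Borel $\phi:X\to Z$ with $\phi(x)\in R_i^{\mathcal{H}}$ (coordinatewise application) whenever $x\in R_i^{\mathcal{G}}$. $\mathcal{G}'$ denotes the Borel $L$-structure on $\mathbb{N}^\mathbb{N}\times[\mathbb{N}]^\mathbb{N}$ in which each vertical section is a copy of $\mathcal{G}$ and nothing else is related: $((s_j,y_j))_j\in R_i^{\mathcal{G}'}$ iff all $s_j$ are equal and $(y_j)_j\in R_i^{\mathcal{G}}$. Borel sets and structures are coded via a fixed standard coding: for a Polish $W$, $\mathbf{BC}(W)\subseteq\mathbb{N}^\mathbb{N}$ is a $\mathbf{\Pi}^1_1$ set of codes, $c\in\mathbf{BC}(W)$ coding the Borel set $\mathbf{A}(W)_c$; a structure is coded by the sequence of codes of its relations. A set $A$ in a Polish space is $\mathbf{\Sigma}^1_2$-hard if every $\mathbf{\Sigma}^1_2$ subset $B$ of any Polish $V$ is $f^{-1}(A)$ for some continuous $f$; complete if moreover $A\in\mathbf{\Sigma}^1_2$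.
   Formalization: Hardness is required only for zero-dimensional Polish V (for V = ℝ continuous maps to ℕ^ℕ are constant, so ''any Polish V'' is impossible); the first claim is stated for Borel L-structures on each fixed uncountable Polish space X. *)

(* Defs.v *)
From HB Require Import structures.
From mathcomp Require Import all_boot all_order all_algebra.
From mathcomp Require Import all_classical all_reals.
From mathcomp Require Import topology_structure topology function_spaces.
From mathcomp Require Import measurable_structure.

Set Implicit Arguments.
Unset Strict Implicit.
Unset Printing Implicit Defensive.

Import Order.TTheory GRing.Theory Num.Theory.
Local Open Scope classical_set_scope.
Local Open Scope ring_scope.

Definition polish (R : realType) (T : topologicalType) : Prop :=
  (exists2 S : set T, countable S & dense S) /\
  exists d : T -> T -> R,
    [/\ forall x y, d x y = 0 <-> x = y,
        forall x y, d x y = d y x,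
        forall x y z, d x z <= d x y + d y z,
        forall (x : T) (A : set T),
          nbhs x A <-> exists2 e : R, 0 < e & [set y | d x y < e] `<=` A
      & forall u : nat -> T,
          (forall e : R, 0 < e -> exists N : nat, forall m n : nat,
             (N <= m)%N -> (N <= n)%N -> d (u m) (u n) < e) ->
          exists l : T, u n @[n --> \oo] --> l].

(* The library's [zero_dimensional] only asks that clopen sets separate points;
   here the clopen sets form a basis. *)
Definition zero_dim (T : topologicalType) : Prop :=
  basis [set U : set T | clopen U].

Definition borel (T : topologicalType) : set (set T) := <<s open >>.

Definition borel_fun (S T : topologicalType) (f : S -> T) : Prop :=
  forall B : set T, borel B -> borel (f @^-1` B).

Definition Baire : topologicalType := {ptws nat -> nat}.

(* Infinite subsets of nat, as increasing enumerations, with the subspace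
   topology inherited from the Baire space. *)
Definition incr_seq : set Baire :=
  [set x : Baire | forall m n : nat, (m < n)%N -> (x m < x n)%N].
Definition InfSub : topologicalType := set_type incr_seq.

Definition le_infty (y x : InfSub) : Prop :=
  infinite_set [set n : nat | ((val y : Baire) n <= (val x : Baire) n)%N].

Definition sigma11 (W : topologicalType) (A : set W) : Prop :=
  exists2 F : set (W * Baire)%type, closed F & A = fst @` F.

Definition pi11 (W : topologicalType) (A : set W) : Prop := sigma11 (~` A).

Definition sigma12 (W : topologicalType) (A : set W) : Prop :=
  exists2 F : set (W * Baire)%type, pi11 F & A = fst @` F.

(* Continuous reductions are only required from zero-dimensional Polish spaces,
   as usual: a continuous map from a connected space to the Baire space is
   constant, so no subset of the Baire space reduces all sigma12 subsets of
   the real line. *)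
Definition sigma12_hard (R : realType) (W : topologicalType) (A : set W) : Prop :=
  forall V : topologicalType, polish R V -> zero_dim V ->
  forall B : set V, sigma12 B ->
  exists2 f : V -> W, continuous f & B = f @^-1` A.

Definition sigma12_complete (R : realType) (W : topologicalType) (A : set W) :
    Prop :=
  sigma12 A /\ sigma12_hard R A.

(* Borel codes relative to an enumeration U of a basis of W: c 0 is the kind of
   node (0: complement, 1: countable union, at least 2: basic open set).
   (n, m) |-> 2 ^ n * (2 * m + 1) is a bijection of nat * nat with the positive
   integers. *)
Inductive codes (W : Type) (U : nat -> set W) : Baire -> set W -> Prop :=
| codes_basic (c : Baire) : (2 <= c 0%N)%N -> codes U c (U (c 1%N))
| codes_compl (c : Baire) (A : set W) :
    c 0%N = 0%N -> codes U (fun n => c n.+1) A -> codes U c (~` A)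
| codes_union (c : Baire) (A : nat -> set W) :
    c 0%N = 1%N -> (forall n : nat, codes U (fun m => c (2 ^ n * m.*2.+1)%N) (A n)) ->
    codes U c (\bigcup_n A n).

Definition BC (W : Type) (U : nat -> set W) : set Baire :=
  [set c | exists A : set W, codes U c A].

(* A code in BC U codes exactly one set, namely this one. *)
Definition coded (W : Type) (U : nat -> set W) (c : Baire) : set W :=
  [set w | exists2 A : set W, codes U c A & A w].

(* Arities: a natural number, or nat itself. *)
Variant arity := Fin of nat | Omega.

Definition arity_index (a : arity) : Type := if a is Fin n then 'I_n else nat.

Definition power (X : topologicalType) (a : arity) : topologicalType :=
  {ptws arity_index a -> X}.

Definition structure (I : Type) (r : I -> arity) (X : topologicalType) : Type :=
  forall i : I, set (power X (r i)).

Definition borel_structure (I : Type) (r : I -> arity) (X : topologicalType)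
    (G : structure r X) : Prop :=
  forall i : I, borel (G i).

Definition homomorphism (I : Type) (r : I -> arity) (X Z : topologicalType)
    (G : structure r X) (H : structure r Z) (phi : X -> Z) : Prop :=
  forall (i : I) (x : power X (r i)), G i x -> H i (fun j => phi (x j)).

Definition admits_borel_hom (I : Type) (r : I -> arity) (X Z : topologicalType)
    (G : structure r X) (H : structure r Z) : Prop :=
  exists2 phi : X -> Z, borel_fun phi & homomorphism G H phi.

(* The restriction lives on the type [set_type B], with the subspace topology,
   so its tuples are automatically tuples of points of B. *)
Definition restr_structure (I : Type) (r : I -> arity) (X : topologicalType)
    (B : set X) (G : structure r X) :
    structure r (set_type B : topologicalType) :=
  fun i => [set x | G i (fun j => val (x j))].
Arguments restr_structure {I r X} B G.

(* The structure G' whose vertical sections are copies of G. *)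
Definition vertical (I : Type) (r : I -> arity) (S X : topologicalType)
    (G : structure r X) : structure r (S * X)%type :=
  fun i => [set p | (forall j k, (p j).1 = (p k).1) /\ G i (fun j => (p j).2)].
Arguments vertical {I r} S {X} G.

Definition Dom : set (InfSub * InfSub)%type := [set p | le_infty p.2 p.1].

Definition Dom_at (x : InfSub) : set InfSub := [set y | le_infty y x].

Lemma Dom_atP (x : InfSub) (y : set_type (Dom_at x)) : (x, val y) \in Dom.
Proof. by rewrite inE; exact: (set_mem (valP y)). Qed.

Definition Dom_sect (Z : Type) (Phi : set_type Dom -> Z) (x : InfSub) :
    set_type (Dom_at x) -> Z :=
  fun y => Phi (exist _ (x, val y) (Dom_atP y)).
Arguments Dom_sect {Z} Phi x y.

(* Main.v *)
(* Upper bound.  Every Borel map into a Polish space factors through a Borel map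
   into the Cantor space, which is coded by a sequence of Borel codes.  Being a
   code is co-analytic, and membership in a coded set is witnessed by a truth
   assignment to the nodes of the code, hence is both analytic and co-analytic
   on codes.  So "there is a code of a Borel homomorphism" is Sigma^1_2.

   Lower bound.  Write v in B iff the tree T(v, a) is well-founded for some a.
   The fibre over c of the set attached to v consists of the y that do not
   eventually dominate any t coding some a and a length-preserving monotone map
   of T(v, a) into S(v, c), where S(v, c) is the tree of attempts to witness
   that c does not code a homomorphism on that very fibre; the self-reference is
   resolved by a universal closed set.
   - If v is not in B and c codes a Borel homomorphism on all fibres, then
     S(v, c) is well-founded while every T(v, a) is not, so there is no t, the
     fibre over c is everything and G has a Borel homomorphism.
   - If v is in B, fix a with T(v, a) well-founded.  The set of c such that the
     rank of S(v, c) is below that of T(v, a) is Borel and all its members code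
     homomorphisms on their own fibres, which can be evaluated in a Borel way by
     Lusin separation; for the other c, a monotone map of T(v, a) into S(v, c)
     is found in a Borel way and bounds the fibre, so that Phi applies.
   Codes of the sections of a Borel set are continuous in the parameter, and a
   Cantor scheme transfers the construction to uncountable Polish spaces. *)

Require Import Defs.
From HB Require Import structures.
From mathcomp Require Import all_boot all_order all_algebra.
From mathcomp Require Import all_classical all_reals.
From mathcomp Require Import topology_structure topology function_spaces.
From mathcomp Require Import measurable_structure.
From mathcomp Require Import zify lra.

Set Implicit Arguments.
Unset Strict Implicit.
Unset Printing Implicit Defensive.

Local Open Scope classical_set_scope.

(** * Pointwise topologies and the Baire space *)

(** Validity of a code is only a co-analytic condition, so a Borel map cannot be expected to
    evaluate all codes; the fibres are built so that it need not. The first coordinate of a point is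
    read as a candidate code, and the fibre over [c] tests [c] alone. A homomorphism looked at over
    its own code passes its test, which makes that fibre the whole space, and there [G] is the
    obstruction. Conversely, one well-founded tree T(v, a) has countable rank, and only codes of
    smaller rank are ever evaluated; over any other [c], even a true code of larger rank, the fibre
    lies in some [Dom_at x], and [Phi] applies without looking at what [c] codes. What keeps the
    fibres Borel is compactness. The sequences below y + M form a compact set, so by Koenig's lemma
    it is a Borel condition that a given closed set contains one of them. This is why the fibres are
    defined by domination, and why they are Borel uniformly in a code of the closed set. The
    uniformity breaks the circle: the test makes sense for every such code, before the intended one
    has been found. *)

Lemma eval_continuous (J : Type) (T : topologicalType) (j : J) :
  continuous (fun x : {ptws J -> T} => x j).
Proof.
move=> x; have /cvg_sup/(_ j) xj : x --> x by exact: cvg_id.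
apply: cvg_trans (@initial_continuous _ _ (fun f : J -> T => f j) x).
by move=> A /= H; exact: xj.
Qed.

Lemma continuous_ptws (J : Type) (S T : topologicalType)
    (f : S -> {ptws J -> T}) :
  (forall j, continuous (fun s => f s j)) -> continuous f.
Proof.
move=> cf s; apply/cvg_sup => j A [_ [[B oB <-] Bfs] sBA].
apply: filterS sBA _; apply: (cf j s).
exact: open_nbhs_nbhs.
Qed.

Definition init_nbhs (x : Baire) : set_system Baire :=
  [set A | exists n, forall y, mkseq y n = mkseq x n -> A y].

Lemma mkseq_leq T (x y : nat -> T) n m :
  m <= n -> mkseq x n = mkseq y n -> mkseq x m = mkseq y m.
Proof.
move=> mn exy; have tk z : mkseq z m = take m (mkseq z n) :> seq T.
  by rewrite /mkseq -map_take take_iota (minn_idPl mn).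
by rewrite !tk exy.
Qed.

Lemma mkseq_eq T (x y : nat -> T) n m :
  m < n -> mkseq x n = mkseq y n -> x m = y m.
Proof. by move=> mn exy; rewrite -(nth_mkseq (x m) x mn) exy nth_mkseq. Qed.

Lemma eq_mkseqP T (x y : nat -> T) n :
  (forall m, m < n -> x m = y m) -> mkseq x n = mkseq y n.
Proof.
by move=> exy; apply/eq_in_map => m; rewrite mem_iota add0n => /andP[_] /exy.
Qed.

Lemma mkseqS T (x : nat -> T) n : mkseq x n.+1 = rcons (mkseq x n) (x n).
Proof. by rewrite /mkseq -addn1 iotaD map_cat cats1. Qed.

Lemma init_nbhs_filter x : Filter (init_nbhs x).
Proof.
split; first by exists 0.
- move=> A B [n An] [m Bm]; exists (maxn n m) => y e; split.
    by apply: An; apply: mkseq_leq e; exact: leq_maxl.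
  by apply: Bm; apply: mkseq_leq e; exact: leq_maxr.
- by move=> A B sAB [n An]; exists n => y /An; exact: sAB.
Qed.

Lemma nbhs_baireE (x : Baire) : nbhs x = init_nbhs x.
Proof.
rewrite eqEsubset; split.
  have FF := init_nbhs_filter x.
  suff H : init_nbhs x --> x by move=> A /H.
  apply/cvg_sup => j A [_ [[B oB <-] Bfs] sBA].
  exists j.+1 => y e; apply: sBA; rewrite /preimage/=.
  by rewrite (mkseq_eq (ltnSn j) e).
move=> A [n An]; apply: filterS An _.
elim: n => [|n IH]; first by apply: filterS filterT.
have : nbhs x [set y : Baire | y n = x n].
  by apply: (@eval_continuous nat nat n x [set k | k = x n]); exact: discrete_set1.
by apply: filterS2 IH => y; rewrite /= !mkseqS => -> ->.
Qed.

Lemma continuous_baireP (W : topologicalType) (f : W -> Baire) :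
  (forall m k, open [set w | f w m = k]) -> continuous f.
Proof.
move=> fo; apply: continuous_ptws => m; apply/continuousP => A _.
have -> : (fun w => f w m) @^-1` A = \bigcup_(k in A) [set w | f w m = k].
  by rewrite predeqE => w; split=> [Aw|[k Ak /= e]]; [exists (f w m)|rewrite /preimage/= e].
by apply: bigcup_open => k _; exact: fo.
Qed.

Lemma continuous_coord (W : topologicalType) (f : W -> Baire) m k :
  continuous f -> open [set w | f w m = k].
Proof.
move=> /continuousP cf; apply: (cf [set x : Baire | x m = k]).
have /continuousP H := @eval_continuous nat nat m.
by apply: (H [set i | i = k]); exact: discrete_open.
Qed.

(** * Borel sets *)

Section Borel.
Variable W : topologicalType.
Implicit Types A B : set W.

Lemma open_borel A : open A -> borel A.
Proof. exact: sub_sigma_algebra. Qed.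

Lemma borelC A : borel A -> borel (~` A).
Proof. by move=> bA; rewrite -setTD; exact: sigma_algebraCD. Qed.

Lemma borel0 : borel (@set0 W).
Proof. exact: sigma_algebra0. Qed.

Lemma borelT : borel [set: W].
Proof. apply: open_borel; exact: openT. Qed.

Lemma borel_bigcup (F : nat -> set W) :
  (forall n, borel (F n)) -> borel (\bigcup_n F n).
Proof. exact: sigma_algebra_bigcup. Qed.

Lemma borel_ex (I : countType) (F : I -> W -> Prop) :
  (forall i, borel (F i)) -> borel [set w | exists i, F i w].
Proof.
move=> bF; have -> : [set w | exists i, F i w] =
    \bigcup_n (if unpickle n is Some i then F i else set0).
  rewrite predeqE => w; split=> [[i Fi]|[n _]].
    by exists (pickle i) => //; rewrite pickleK.
  by case: unpickle => // i Fi; exists i.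
by apply: borel_bigcup => n; case: unpickle => [i|]; [exact: bF|exact: borel0].
Qed.

Lemma borel_all (I : countType) (F : I -> W -> Prop) :
  (forall i, borel (F i)) -> borel [set w | forall i, F i w].
Proof.
move=> bF; have -> : [set w | forall i, F i w] = ~` [set w | exists i, ~ F i w].
  rewrite predeqE => w; split=> [Fw [i nF]|H i]; first exact: nF.
  by apply: contrapT => nF; apply: H; exists i.
by apply: borelC; apply: borel_ex => i; apply: borelC; exact: bF.
Qed.

Lemma borelU A B : borel A -> borel B -> borel [set w | A w \/ B w].
Proof.
move=> bA bB; have -> : [set w | A w \/ B w] =
    [set w | exists b : bool, (if b then A else B) w].
  by rewrite predeqE => w; split=> [[]|[[]]]; [exists true|exists false|left|right].
by apply: borel_ex => -[].
Qed.

Lemma borelI A B : borel A -> borel B -> borel [set w | A w /\ B w].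
Proof.
move=> bA bB; have -> : [set w | A w /\ B w] =
    [set w | forall b : bool, (if b then A else B) w].
  by rewrite predeqE => w; split=> [[? ?] []|H]//; split; [exact: (H true)|exact: (H false)].
by apply: borel_all => -[].
Qed.

Lemma borel_const (P : Prop) : borel [set _ : W | P].
Proof.
have [p|np] := pselect P.
  have -> : [set _ : W | P] = setT by rewrite predeqE.
  exact: borelT.
have -> : [set _ : W | P] = set0 by rewrite predeqE.
exact: borel0.
Qed.

Lemma borel_imply A B : borel A -> borel B -> borel [set w | A w -> B w].
Proof.
move=> bA bB; have -> : [set w | A w -> B w] = [set w | (~` A) w \/ B w].
  rewrite predeqE => w; split=> [AB|[?|?] //].
  by have [/AB|] := pselect (A w); [right|left].
by apply: borelU => //; exact: borelC.
Qed.

Lemma borel_ind (P : set W -> Prop) :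
  (forall A, open A -> P A) -> (forall A, P A -> P (~` A)) ->
  (forall F : nat -> set W, (forall n, P (F n)) -> P (\bigcup_n F n)) ->
  forall A, borel A -> P A.
Proof.
move=> Po PC PU A bA; apply: (bA P); split => //; split => //.
- exact/Po/open0.
- by move=> B PB; rewrite setTD; exact: PC.
Qed.

End Borel.

Lemma borel_fun_open (S T : topologicalType) (f : S -> T) :
  (forall A, open A -> borel (f @^-1` A)) -> borel_fun f.
Proof.
move=> fo; apply: borel_ind => // [A bA|F bF].
  by rewrite preimage_setC; exact: borelC.
by rewrite preimage_bigcup; exact: borel_bigcup.
Qed.

Lemma continuous_borel (S T : topologicalType) (f : S -> T) :
  continuous f -> borel_fun f.
Proof.
by move=> /continuousP cf; apply: borel_fun_open => A /cf; exact: open_borel.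
Qed.

Lemma borel_comp (S T U : topologicalType) (f : S -> T) (g : T -> U) :
  borel_fun f -> borel_fun g -> borel_fun (g \o f).
Proof. by move=> bf bg A /bg/bf. Qed.

Definition cylinder (s : seq nat) : set Baire := [set x | mkseq x (size s) = s].

Lemma open_cylinder s : open (cylinder s).
Proof.
rewrite openE => x xs; rewrite /interior nbhs_baireE; exists (size s) => y e.
by rewrite /cylinder /= e.
Qed.

Lemma open_baireE (A : set Baire) : open A ->
  A = [set x | exists s, cylinder s `<=` A /\ cylinder s x].
Proof.
rewrite openE => oA; rewrite predeqE => x; split=> [/oA|[s [sA]]]; last exact: sA.
rewrite /interior nbhs_baireE => -[n An]; exists (mkseq x n).
by rewrite /cylinder /= size_mkseq; split=> // y /=; exact: An.
Qed.

Lemma borel_baireP (W : topologicalType) (f : W -> Baire) :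
  (forall m k, borel [set w | f w m = k]) -> borel_fun f.
Proof.
move=> fb; apply: borel_fun_open => A /open_baireE ->.
apply: borel_ex => s; apply: borelI; first exact: borel_const.
have -> : (fun w => cylinder s (f w)) =
    [set w | forall m : 'I_(size s), f w m = nth 0 s m].
  rewrite predeqE => w; split => [e m|e].
    by have := congr1 (fun l => nth 0 l m) e; rewrite nth_mkseq.
  apply: (@eq_from_nth _ 0); rewrite size_mkseq// => m ms.
  by rewrite nth_mkseq//; exact: (e (Ordinal ms)).
by apply: borel_all => m; exact: fb.
Qed.

Lemma borel_coord (W : topologicalType) (f : W -> Baire) m k :
  borel_fun f -> borel [set w | f w m = k].
Proof.
move=> bf; apply: (bf [set x : Baire | x m = k]); apply: open_borel.
by apply: (@continuous_coord Baire id m k) => x; exact: cvg_id.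
Qed.

(** * Discrete-valued functions measurable for a lattice of sets *)

(** Open sets and Borel sets are the two instances. For maps into countable types it is enough to
    control preimages of points, and complements are then never taken, so one family of lemmas gives
    both continuity and Borel measurability. *)
Record sigma_lattice (W : Type) (C : set (set W)) : Prop := SigmaLattice {
  latT : C setT;
  lat0 : C set0;
  latI : forall A B, C A -> C B -> C (A `&` B);
  latU : forall F : nat -> set W, (forall n, C (F n)) -> C (\bigcup_n F n) }.

Lemma open_lattice (W : topologicalType) : sigma_lattice (@open W).
Proof.
split; [exact: openT|exact: open0|by move=> ? ?; exact: openI|].
by move=> F Fo; apply: bigcup_open.
Qed.

Lemma borel_lattice (W : topologicalType) : sigma_lattice (@borel W).
Proof.
split; [exact: borelT|exact: borel0|by move=> ? ?; exact: borelI|].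
exact: borel_bigcup.
Qed.

Section Simple.
Variables (W : Type) (C : set (set W)) (lC : sigma_lattice C).

Definition simple (T : Type) (f : W -> T) := forall t, C [set w | f w = t].

Definition csimple (x : W -> Baire) := forall m, simple (x^~ m).

Lemma simple_pred (T : countType) (f : W -> T) (P : T -> Prop) :
  simple f -> C [set w | P (f w)].
Proof.
move=> sf; have -> : [set w | P (f w)] = \bigcup_n
    (if unpickle n is Some t then if `[< P t >] then [set w | f w = t] else set0
     else set0).
  rewrite predeqE => w; split=> [Pw|[n _]].
    exists (pickle (f w)) => //; rewrite pickleK.
    by case: asboolP.
  by case: unpickle => // t; case: asboolP => // Pt /= e; rewrite /= e.
apply: (latU lC) => n; case: unpickle => [t|]; last exact: lat0.
by case: asboolP => // _; exact: lat0.
Qed.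

Lemma simple_comp (T : countType) (T' : Type) (g : T -> T') (f : W -> T) :
  simple f -> simple (fun w => g (f w)).
Proof. by move=> sf t; exact: (simple_pred (fun u => g u = t) sf). Qed.

Lemma simple_pair (T T' : Type) (f : W -> T) (g : W -> T') :
  simple f -> simple g -> simple (fun w => (f w, g w)).
Proof.
move=> sf sg [t t']; have -> : [set w | (f w, g w) = (t, t')] =
    [set w | f w = t] `&` [set w | g w = t'].
  by rewrite predeqE => w; split=> [[ef eg]|[ef eg]]; [split|congr pair].
exact: (latI lC).
Qed.

Lemma simple_cst (T : Type) (t : T) : simple (fun=> t).
Proof.
move=> t'; have [->|ntt'] := pselect (t = t').
  by have -> : [set _ : W | t' = t'] = setT; [rewrite predeqE|exact: latT].
by have -> : [set _ : W | t = t'] = set0; [rewrite predeqE|exact: lat0].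
Qed.

Lemma simple_app (x : W -> Baire) (n : W -> nat) :
  csimple x -> simple n -> simple (fun w => x w (n w)).
Proof.
move=> sx sn t; have -> : [set w | x w (n w) = t] =
    \bigcup_m ([set w | n w = m] `&` [set w | x w m = t]).
  by rewrite predeqE => w; split=> [e|[m _ [/= e1 e2]]]; [exists (n w)|rewrite e1].
by apply: (latU lC) => m; apply: (latI lC); [exact: sn|exact: sx].
Qed.

Lemma simple_mkseq (x : W -> Baire) n :
  csimple x -> simple (fun w => mkseq (x w) n).
Proof.
move=> sx; elim: n => [|n IH]; first exact: simple_cst.
have := simple_comp (fun p => rcons p.1 p.2) (simple_pair IH (sx n)).
by congr simple; apply/funext => w; rewrite /= mkseqS.
Qed.

End Simple.

Lemma simple_dep (W : Type) (C : set (set W)) (T : countType) (T' : Type)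
    (f : W -> T) (g : T -> W -> T') :
  sigma_lattice C -> simple C f -> (forall t, simple C (g t)) ->
  simple C (fun w => g (f w) w).
Proof.
move=> lC sf sg u; have -> : [set w | g (f w) w = u] = \bigcup_n
    (if unpickle n is Some t then [set w | f w = t] `&` [set w | g t w = u]
     else set0).
  rewrite predeqE => w; split=> [e|[n _]].
    by exists (pickle (f w)) => //; rewrite pickleK.
  by case: unpickle => // t [/= -> ->].
apply: (latU lC) => n; case: unpickle => [t|]; last exact: lat0.
by apply: (latI lC); [exact: sf|exact: sg].
Qed.

Lemma continuous_simple (W : topologicalType) (x : W -> Baire) :
  continuous x -> csimple (@open W) x.
Proof. by move=> cx m k; exact: continuous_coord. Qed.

Lemma borel_simple (W : topologicalType) (x : W -> Baire) :
  borel_fun x -> csimple (@borel W) x.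
Proof. by move=> bx m k; exact: borel_coord. Qed.

(** * Coding sequences of reals by reals *)

Definition col (n : nat) (x : Baire) : Baire := fun m => x (pickle (n, m)).

Definition merge (xs : nat -> Baire) : Baire :=
  fun k => if unpickle k is Some (n, m) then xs n m else 0.

Lemma col_merge n xs : col n (merge xs) = xs n.
Proof. by apply/funext => m; rewrite /col /merge pickleK. Qed.

Definition tup (l : seq Baire) : Baire := merge (nth (fun=> 0) l).

Lemma col_tup n l : col n (tup l) = nth (fun=> 0) l n.
Proof. exact: col_merge. Qed.

Section SimpleCoding.
Variables (W : Type) (C : set (set W)) (lC : sigma_lattice C).

Lemma csimple_col n (x : W -> Baire) :
  csimple C x -> csimple C (fun w => col n (x w)).
Proof. by move=> sx m; exact: sx. Qed.

Lemma csimple_merge (xs : nat -> W -> Baire) :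
  (forall n, csimple C (xs n)) -> csimple C (fun w => merge (xs^~ w)).
Proof.
move=> sx m; rewrite /merge; case: unpickle => [[n k]|]; first exact: sx.
exact: simple_cst.
Qed.

End SimpleCoding.

Lemma continuous_col n : continuous (col n).
Proof. by apply: continuous_ptws => m; exact: eval_continuous. Qed.

Lemma continuous_merge (W : topologicalType) (xs : nat -> W -> Baire) :
  (forall n, continuous (xs n)) -> continuous (fun w => merge (xs^~ w)).
Proof.
move=> cx; apply: continuous_baireP => m k; apply: csimple_merge => //.
  exact: open_lattice.
by move=> n; exact: continuous_simple.
Qed.

Lemma continuous_pair (W S T : topologicalType) (f : W -> S) (g : W -> T) :
  continuous f -> continuous g -> continuous (fun w => (f w, g w)).
Proof. by move=> cf cg w; apply: cvg_pair; [exact: cf|exact: cg]. Qed.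

Lemma continuous_fst (S T : topologicalType) : continuous (@fst S T).
Proof. by move=> w; exact: cvg_fst. Qed.

Lemma continuous_snd (S T : topologicalType) : continuous (@snd S T).
Proof. by move=> w; exact: cvg_snd. Qed.

Lemma continuous_id (S : topologicalType) : continuous (@id S).
Proof. by move=> w; exact: cvg_id. Qed.

Lemma continuous_o (S T U : topologicalType) (f : S -> T) (g : T -> U) :
  continuous f -> continuous g -> continuous (g \o f).
Proof. by move=> cf cg w; apply: continuous_comp; [exact: cf|exact: cg]. Qed.

Lemma continuous_tup2 : continuous (fun p : Baire * Baire => tup [:: p.1; p.2]).
Proof.
have := @continuous_merge (Baire * Baire)%type
  (fun n p => nth (fun=> 0) [:: p.1; p.2] n).
apply; case=> [|[|n]] /=; [exact: continuous_fst|exact: continuous_snd|].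
by rewrite nth_nil; exact: cst_continuous.
Qed.

(** * Analytic sets *)

Lemma preimage_closed (S T : topologicalType) (f : S -> T) (F : set T) :
  continuous f -> closed F -> closed (f @^-1` F).
Proof. by move=> cf cF; apply: closed_comp => // x _; exact: cf. Qed.

Section Sigma11.
Variable W : topologicalType.
Implicit Types A B : set W.

Lemma sigma11P A (F : set (W * Baire)%type) :
  closed F -> (forall w, A w <-> exists t, F (w, t)) -> sigma11 A.
Proof.
move=> cF AF; exists F => //; rewrite predeqE => w; split=> [/AF[t Ft]|].
  by exists (w, t).
by move=> [[w' t] /= Ft <-]; apply/AF; exists t.
Qed.

Lemma sigma11E A : sigma11 A ->
  exists2 F : set (W * Baire)%type, closed F & forall w, A w <-> exists t, F (w, t).
Proof.
move=> [F cF ->]; exists F => // w; split=> [[[w' t] /= Ft <-]|[t Ft]].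
  by exists t.
by exists (w, t).
Qed.

Lemma closed_sigma11 A : closed A -> sigma11 A.
Proof.
move=> cA; apply: (@sigma11P A (fst @^-1` A)).
  by apply: preimage_closed => //; exact: continuous_fst.
by move=> w; split=> [Aw|[]//]; exists (fun=> 0).
Qed.

End Sigma11.

Lemma sigma11_preimage (V W : topologicalType) (f : V -> W) (A : set W) :
  continuous f -> sigma11 A -> sigma11 [set v | A (f v)].
Proof.
move=> cf /sigma11E[F cF AF].
apply: (@sigma11P _ _ ((fun p : V * Baire => (f p.1, p.2)) @^-1` F)).
  apply: preimage_closed cF; apply: continuous_pair; last exact: continuous_snd.
  by apply: continuous_o cf; exact: continuous_fst.
by move=> v; exact: AF.
Qed.

Lemma sigma11_ex (W : topologicalType) (A : W -> Baire -> Prop) :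
  sigma11 [set p : W * Baire | A p.1 p.2] -> sigma11 [set w | exists t, A w t].
Proof.
move=> /sigma11E[F cF AF].
apply: (@sigma11P _ _
  ((fun p : W * Baire => ((p.1, col 0 p.2), col 1 p.2)) @^-1` F)).
  have cc n : continuous (fun p : W * Baire => col n p.2).
    exact: continuous_o (@continuous_snd W Baire) (@continuous_col n).
  apply: preimage_closed cF; apply: continuous_pair => //.
  by apply: continuous_pair => //; exact: continuous_fst.
move=> w; split=> [[t /(AF (w, t))[u Fu]]|[u Fu]].
  by exists (tup [:: t; u]); rewrite /preimage/= !col_tup.
by exists (col 0 u); apply/(AF (w, col 0 u)); exists (col 1 u).
Qed.

Lemma sigma11_bigcup (W : topologicalType) (A : nat -> W -> Prop) :
  (forall n, sigma11 (A n)) -> sigma11 [set w | exists n, A n w].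
Proof.
move=> sA; have /choice[F FP] n : exists F : set (W * Baire)%type,
    closed F /\ forall w, A n w <-> exists t, F (w, t).
  by have [F] := sigma11E (sA n); exists F.
pose f (p : W * Baire) := (p.1, col 1 p.2).
have cf : continuous f.
  apply: continuous_pair; first exact: continuous_fst.
  exact: continuous_o (@continuous_snd W Baire) (@continuous_col 1).
(* The number [col 0 p.2 0] selects one of the sets and column 1 is its witness. The selector is
   locally constant, which keeps the relation closed although the union is infinite. *)
apply: (@sigma11P _ _ [set p | F (col 0 p.2 0) (f p)]).
  rewrite -openC; have -> : ~` [set p | F (col 0 p.2 0) (f p)] =
      \bigcup_n ([set p : W * Baire | col 0 p.2 0 = n] `&` f @^-1` (~` F n)).
    rewrite predeqE => p; split=> [nF|[n _ [/= <-]]//].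
    by exists (col 0 p.2 0).
  apply: bigcup_open => n _; apply: openI.
    apply: (@continuous_coord _ (fun p : W * Baire => col 0 p.2)).
    exact: continuous_o (@continuous_snd W Baire) (@continuous_col 0).
  by move/continuousP: cf; apply; rewrite openC; have [] := FP n.
move=> w; split=> [[n /(FP n).2[t Ft]]|[u Fu]].
  by exists (tup [:: (fun=> n); t]); rewrite /= /f /= !col_tup.
by exists (col 0 u 0); apply/(FP _).2; exists (col 1 u).
Qed.

Lemma sigma11_bigcap (W : topologicalType) (A : nat -> W -> Prop) :
  (forall n, sigma11 (A n)) -> sigma11 [set w | forall n, A n w].
Proof.
move=> sA; have /choice[F FP] n : exists F : set (W * Baire)%type,
    closed F /\ forall w, A n w <-> exists t, F (w, t).
  by have [F] := sigma11E (sA n); exists F.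
pose f n (p : W * Baire) := (p.1, col n p.2).
have cf n : continuous (f n).
  apply: continuous_pair; first exact: continuous_fst.
  exact: continuous_o (@continuous_snd W Baire) (@continuous_col n).
apply: (@sigma11P _ _ (\bigcap_n (f n @^-1` F n))).
  by apply: closed_bigI => n _; apply: preimage_closed; [exact: cf|have [] := FP n].
move=> w; split=> [Aw|[u Fu] n].
  have /choice[t Ft] n : exists t, F n (w, t) by apply/(FP n).2.
  by exists (merge t) => n _; rewrite /preimage/= /f /= col_merge.
by apply/(FP n).2; exists (col n u); exact: (Fu n).
Qed.

Lemma sigma11_const (W : topologicalType) (P : Prop) : sigma11 [set _ : W | P].
Proof.
apply: closed_sigma11; have [p|np] := pselect P.
  have -> : [set _ : W | P] = setT by rewrite predeqE.
  exact: closedT.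
have -> : [set _ : W | P] = set0 by rewrite predeqE.
exact: closed0.
Qed.

Lemma sigma11_exC (W : topologicalType) (I : countType) (A : I -> W -> Prop) :
  (forall i, sigma11 (A i)) -> sigma11 [set w | exists i, A i w].
Proof.
move=> sA; have -> : [set w | exists i, A i w] = [set w | exists n,
    if unpickle n is Some i then A i w else False].
  rewrite predeqE => w; split=> [[i Ai]|[n]].
    by exists (pickle i); rewrite pickleK.
  by case: unpickle => // i Ai; exists i.
apply: sigma11_bigcup => n; case: unpickle => [i|]; first exact: sA.
exact: sigma11_const.
Qed.

Lemma sigma11_allC (W : topologicalType) (I : countType) (A : I -> W -> Prop) :
  (forall i, sigma11 (A i)) -> sigma11 [set w | forall i, A i w].
Proof.
move=> sA; have -> : [set w | forall i, A i w] = [set w | forall n,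
    if unpickle n is Some i then A i w else True].
  rewrite predeqE => w; split=> [Ai n|H i]; first by case: unpickle.
  by have := H (pickle i); rewrite pickleK.
apply: sigma11_bigcap => n; case: unpickle => [i|]; first exact: sA.
exact: sigma11_const.
Qed.

Lemma sigma11U (W : topologicalType) (A B : set W) :
  sigma11 A -> sigma11 B -> sigma11 [set w | A w \/ B w].
Proof.
move=> bA bB; have -> : [set w | A w \/ B w] =
    [set w | exists b : bool, (if b then A else B) w].
  by rewrite predeqE => w; split=> [[]|[[]]]; [exists true|exists false|left|right].
by apply: sigma11_exC => -[].
Qed.

Lemma sigma11I (W : topologicalType) (A B : set W) :
  sigma11 A -> sigma11 B -> sigma11 [set w | A w /\ B w].
Proof.
move=> bA bB; have -> : [set w | A w /\ B w] =
    [set w | forall b : bool, (if b then A else B) w].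
  by rewrite predeqE => w; split=> [[? ?] []|H]//; split; [exact: (H true)|exact: (H false)].
by apply: sigma11_allC => -[].
Qed.

Lemma baire_borel_sigma11 (A : set Baire) : borel A -> sigma11 A.
Proof.
move=> bA; suff [] : sigma11 A /\ sigma11 (~` A) by [].
apply: (@borel_ind _ (fun A => sigma11 A /\ sigma11 (~` A))) bA.
- move=> {}A oA; split; last by apply: closed_sigma11; rewrite closedC.
  rewrite (open_baireE oA); apply: sigma11_exC => s; apply: sigma11I.
    exact: sigma11_const.
  apply: closed_sigma11; rewrite -openC.
  have -> : ~` cylinder s =
      [set x | exists s', [/\ size s' = size s, s' <> s & cylinder s' x]].
    rewrite predeqE => x; split=> [nx|[s' [e ne x' x'']]].
      by exists (mkseq x (size s)); rewrite /cylinder /= size_mkseq.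
    by apply: ne; rewrite -x'' -{1}x' e.
  rewrite openE => x [s' [e ne xs']]; rewrite /interior nbhsE.
  exists (cylinder s'); first by split=> //; exact: open_cylinder.
  by move=> y ys; exists s'.
- by move=> {}A [sA sC]; rewrite setCK.
- move=> F H; split.
    have -> : \bigcup_n F n = [set w | exists n, F n w].
      by rewrite predeqE => w; split=> [[n _ Fn]|[n Fn]]; exists n.
    by apply: sigma11_bigcup => n; have [] := H n.
  rewrite setC_bigcup.
  have -> : \bigcap_n ~` F n = [set w | forall n, (~` F n) w].
    by rewrite predeqE => w; split=> [Fn n|Fn n _]; exact: Fn.
  by apply: sigma11_bigcap => n; have [] := H n.
Qed.

(* The code spaces below are continuous retracts of the Baire space, which is
   how the Borel sets of these spaces are seen to be analytic. *)
Definition retract_baire (W : topologicalType) :=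
  exists (f : W -> Baire) (g : Baire -> W),
    [/\ continuous f, continuous g & cancel f g].

Lemma borel_sigma11 (W : topologicalType) (A : set W) :
  retract_baire W -> borel A -> sigma11 A.
Proof.
move=> [f [g [cf cg fg]]] bA.
have /(sigma11_preimage cf) : sigma11 (g @^-1` A).
  by apply: baire_borel_sigma11; exact: continuous_borel.
by congr sigma11; rewrite predeqE => w; rewrite /preimage/= fg.
Qed.

Lemma retract_baire_id : retract_baire Baire.
Proof. by exists id, id; split=> //; exact: continuous_id. Qed.

Lemma retract_baireM (V W : topologicalType) :
  retract_baire V -> retract_baire W -> retract_baire (V * W)%type.
Proof.
move=> [f [g [cf cg fg]]] [f' [g' [cf' cg' fg']]].
exists (fun p => tup [:: f p.1; f' p.2]), (fun x => (g (col 0 x), g' (col 1 x))).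
split; last by move=> [v w]; rewrite /= !col_tup /= fg fg'.
- have c : continuous (fun p : V * W => (f p.1, f' p.2)).
    apply: continuous_pair.
      exact: continuous_o (@continuous_fst V W) cf.
    exact: continuous_o (@continuous_snd V W) cf'.
  exact: continuous_o c continuous_tup2.
- apply: continuous_pair.
    exact: continuous_o (@continuous_col 0) cg.
  exact: continuous_o (@continuous_col 1) cg'.
Qed.

(** * Trees of closed relations and Lusin separation *)

Definition init_tree (F : Baire -> Baire -> Prop) (s t : seq nat) : Prop :=
  exists x y, [/\ F x y, mkseq x (size s) = s & mkseq y (size t) = t].

Lemma closed_init_tree (F : set (Baire * Baire)%type) x y : closed F ->
  F (x, y) <->
  forall n, init_tree (fun x y => F (x, y)) (mkseq x n) (mkseq y n).
Proof.
move=> cF; split=> [Fxy n|H]; first by exists x, y; rewrite !size_mkseq.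
apply: cF => A [[P Q] [/=]]; rewrite !nbhs_baireE => -[n Pn] [m Qm] PQA.
have [x' [y' []]] := H (maxn n m); rewrite !size_mkseq => F' ex ey.
exists (x', y'); split=> //; apply: PQA; split=> /=.
  by apply: Pn; apply: mkseq_leq ex; exact: leq_maxl.
by apply: Qm; apply: mkseq_leq ey; exact: leq_maxr.
Qed.

Lemma sigma11_tree (A : set Baire) : sigma11 A ->
  exists T : seq nat -> seq nat -> Prop,
    forall x, A x <-> exists y, forall n, T (mkseq x n) (mkseq y n).
Proof.
move=> /sigma11E[F cF AF]; exists (init_tree (fun x y => F (x, y))) => x.
by split=> [/AF[y]|[y]] H; [exists y; exact/closed_init_tree|
  apply/AF; exists y; exact/closed_init_tree].
Qed.

Section Separation.
Variables (T1 T2 : seq nat -> seq nat -> Prop).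

Let part (T : seq nat -> seq nat -> Prop) (st : seq nat * seq nat) : set Baire :=
  [set x | mkseq x (size st.1) = st.1 /\ exists y,
     mkseq y (size st.2) = st.2 /\ forall n, T (mkseq x n) (mkseq y n)].

Let sep (A B : set Baire) :=
  exists C, [/\ borel C, A `<=` C & B `<=` ~` C].

Let rc (st : seq nat * seq nat) (p : nat * nat) :=
  (rcons st.1 p.1, rcons st.2 p.2).

Let part_split T st x : part T st x -> exists p, part T (rc st p) x.
Proof.
move=> [xs [y [ys Txy]]]; exists (x (size st.1), y (size st.2)).
split=> /=; first by rewrite size_rcons mkseqS xs.
by exists y; rewrite size_rcons mkseqS ys.
Qed.

Let sep_split st st' :
  (forall p p', sep (part T1 (rc st p)) (part T2 (rc st' p'))) ->
  sep (part T1 st) (part T2 st').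
Proof.
move=> H; have /choice[C CP] (pp : (nat * nat) * (nat * nat)) : exists C,
    [/\ borel C, part T1 (rc st pp.1) `<=` C & part T2 (rc st' pp.2) `<=` ~` C].
  exact: H.
exists [set x | exists p, forall p', C (p, p') x]; split.
- apply: borel_ex => p; apply: borel_all => p'.
  by have [] := CP (p, p').
- move=> x /part_split[p px]; exists p => p'.
  by have [_ + _] := CP (p, p'); exact.
- move=> x /part_split[p' px] [p /(_ p')]; have [_ _] := CP (p, p').
  by move=> /(_ x px).
Qed.

(** Separators of all pairs of pieces combine, by a countable union of countable intersections, into
    a separator of the whole ([sep_split]). So if the two projections were inseparable, inseparable
    pieces could be followed down forever. Inseparable pieces are nonempty, hence the limits are
    branches of [T1] and [T2]; their first coordinates agree, since otherwise a cylinder would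
    separate; this is a common point. *)
Lemma lusin_separation :
  (forall x : Baire, ~ ((exists y, forall n, T1 (mkseq x n) (mkseq y n)) /\
                (exists y, forall n, T2 (mkseq x n) (mkseq y n)))) ->
  exists C : set Baire, [/\ borel C,
    forall x y, (forall n, T1 (mkseq x n) (mkseq y n)) -> C x &
    forall x y, (forall n, T2 (mkseq x n) (mkseq y n)) -> ~ C x].
Proof.
move=> disj; suff [C [bC H1 H2]] : sep (part T1 ([::], [::])) (part T2 ([::], [::])).
  by exists C; split=> // x y Ty; [apply: H1|apply: H2]; split=> //; exists y.
apply: contrapT => nsep.
pose X := {q : (seq nat * seq nat) * (seq nat * seq nat) |
           ~ sep (part T1 q.1) (part T2 q.2)}.
have step (q : X) : {q' : X | exists pp, sval q' = (rc (sval q).1 pp.1, rc (sval q).2 pp.2)}.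
  apply: cid; case: q => -[st st'] /= ns.
  have [pp npp] : exists pp, ~ sep (part T1 (rc st pp.1)) (part T2 (rc st' pp.2)).
    apply: contrapT => /forallNP H; apply: ns; apply: sep_split => p p'.
    by apply: contrapT; exact: (H (p, p')).
  by exists (exist _ (rc st pp.1, rc st' pp.2) npp); exists pp.
have [f [f0 fS]] := dependent_choice step (exist _ (([::], [::]), ([::], [::])) nsep).
have /choice[pp ppE] := fS.
pose x n := (pp n).1.1; pose y n := (pp n).1.2.
pose x' n := (pp n).2.1; pose y' n := (pp n).2.2.
have fE n : sval (f n) = ((mkseq x n, mkseq y n), (mkseq x' n, mkseq y' n)).
  elim: n => [|n IH]; first by rewrite f0.
  by rewrite ppE IH /= /rc !mkseqS.
have ne1 n : exists z, part T1 (mkseq x n, mkseq y n) z.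
  apply: contrapT => /forallNP H; have := svalP (f n); rewrite fE; apply.
  exists set0; split; [exact: borel0| |by move=> z _ []].
  by move=> z pz; have := H z; apply.
have ne2 n : exists z, part T2 (mkseq x' n, mkseq y' n) z.
  apply: contrapT => /forallNP H; have := svalP (f n); rewrite fE; apply.
  exists setT; split; [exact: borelT|by []|].
  by move=> z pz; have := H z; case.
have exx : x = x'.
  apply/funext => n; apply: contrapT => nx.
  have := svalP (f n.+1); rewrite fE; apply.
  exists (cylinder (mkseq x n.+1)); split.
  - by apply: open_borel; exact: open_cylinder.
  - by move=> z [].
  - move=> z [e _] e'; apply: nx; apply: (mkseq_eq (ltnSn n)).
    have {}e : mkseq z n.+1 = mkseq x' n.+1 by rewrite -[RHS]e size_mkseq.
    have {}e' : mkseq z n.+1 = mkseq x n.+1 by rewrite -[RHS]e' size_mkseq.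
    by rewrite -e -e'.
apply: (disj x); split.
  exists y => n; have [z [/= ez [w [ew /(_ n)]]]] := ne1 n.
  by rewrite !size_mkseq in ez ew; rewrite ez ew.
exists y' => n; have [z [/= ez [w [ew /(_ n)]]]] := ne2 n.
by rewrite !size_mkseq in ez ew; rewrite ez ew exx.
Qed.

End Separation.

Lemma sigma11_separation (A B : set Baire) : sigma11 A -> sigma11 B ->
  (forall x, A x -> B x -> False) ->
  exists C, [/\ borel C, A `<=` C & B `<=` ~` C].
Proof.
move=> /sigma11_tree[T1 A1] /sigma11_tree[T2 B2] disj.
have [|C [bC H1 H2]] := @lusin_separation T1 T2.
  by move=> x [/A1 Ax /B2 Bx]; exact: disj Bx.
exists C; split=> // x; first by move/A1 => [y]; exact: H1.
by move/B2 => [y]; exact: H2.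
Qed.

(** * Borel codes *)

(** One labelling serves both kinds of inner nodes: label 0 is the subcode of a complement, label
    [n.+1] the [n]-th subcode of a union. [valid] tells which labels the kind of the node admits. *)
Definition child (l : nat) (c : Baire) : Baire :=
  if l is n.+1 then fun m => c (2 ^ n * m.*2.+1) else fun m => c m.+1.

Definition valid (c : Baire) (l : nat) : bool :=
  (c 0 == 0) && (l == 0) || (c 0 == 1) && (0 < l).

Definition node (c : Baire) (p : seq nat) : Baire :=
  foldl (fun d l => child l d) c p.

Lemma node_rcons c p l : node c (rcons p l) = child l (node c p).
Proof. by rewrite /node foldl_rcons. Qed.

Definition child_of (c' c : Baire) := exists2 l, valid c l & c' = child l c.

Lemma codes_child (W : Type) (U : nat -> set W) c A l :
  codes U c A -> valid c l -> BC U (child l c).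
Proof.
case=> {c A} [c c0|c A c0 cA|c A c0 cA]; rewrite /valid; case: l => [|l].
- by move=> /orP[/andP[/eqP e]|/andP[/eqP e]]; rewrite e in c0.
- by move=> /orP[/andP[/eqP e]|/andP[/eqP e]]; rewrite e in c0.
- by move=> _; exists A.
- by rewrite c0.
- by rewrite c0.
- by move=> _; exists (A l); exact: cA.
Qed.

(** Well-foundedness of the tree of subcodes does not mention [U]. Hence validity of a code is the
    same over every basis, and its failure is witnessed by an infinite branch, an analytic
    condition. *)
Lemma BC_acc (W : Type) (U : nat -> set W) c : BC U c <-> Acc child_of c.
Proof.
split=> [[A]|].
  elim=> {c A} [c c0|c A c0 _ IH|c A c0 _ IH]; constructor=> _ [l + ->];
    rewrite /valid.
  - by move=> /orP[/andP[/eqP e]|/andP[/eqP e]]; rewrite e in c0.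
  - by rewrite c0; case: l.
  - by rewrite c0; case: l => [|l _]; [by []|exact: (IH l)].
elim=> {}c _ IH; case E : (c 0) => [|[|k]].
- have [|A cA] := IH (child 0 c); first by exists 0 => //; rewrite /valid E.
  by exists (~` A); exact: codes_compl.
- have /choice[A cA] n : exists A, codes U (child n.+1 c) A.
    by apply: IH; exists n.+1 => //; rewrite /valid E.
  by exists (\bigcup_n A n); exact: codes_union.
- by exists (U (c 1)); apply: codes_basic; rewrite E.
Qed.

Lemma BC_eq (V W : Type) (U : nat -> set V) (U' : nat -> set W) c :
  BC U c <-> BC U' c.
Proof. by split=> /BC_acc ?; apply/BC_acc. Qed.

Lemma mkseqSl T (x : nat -> T) n : mkseq x n.+1 = x 0 :: mkseq (fun m => x m.+1) n.
Proof.
by rewrite /mkseq /= -[1]addn0 iotaDl -map_comp.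
Qed.

Lemma acc_child_branch c : ~ Acc child_of c <->
  exists q : Baire, forall n, valid (node c (mkseq q n)) (q n).
Proof.
split=> [nA|[q qP] ac]; last first.
  elim: ac q qP => {}c _ IH q qP.
  apply: (IH (child (q 0) c) _ (fun m => q m.+1)).
    by exists (q 0) => //; exact: (qP 0).
  by move=> n; have := qP n.+1; rewrite mkseqSl.
pose X := {c | ~ Acc child_of c}.
have step (d : X) : {d' : X | child_of (sval d') (sval d)}.
  apply: cid; case: d => d nd /=; apply: contrapT => /forallNP H; apply: nd.
  constructor=> d' dd'; apply: contrapT => nd'; exact: (H (exist _ d' nd')).
have [f [f0 fS]] := dependent_choice step (exist _ c nA).
have /choice[q qP] n : exists l, valid (sval (f n)) l /\
    sval (f n.+1) = child l (sval (f n)).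
  by have [l] := fS n; exists l.
have fE n : sval (f n) = node c (mkseq q n).
  elim: n => [|n IH]; first by rewrite f0.
  by rewrite (qP n).2 mkseqS node_rcons IH.
by exists q => n; rewrite -fE; exact: (qP n).1.
Qed.

Lemma codes_unique (W : Type) (U : nat -> set W) c A B :
  codes U c A -> codes U c B -> A = B.
Proof.
move=> cA; elim: cA B => {c A} [c c0|c A c0 _ IH|c A c0 _ IH] B cB.
- by case: cB c0 => {c B} [c|c A ->|c A ->].
- by case: cB c0 IH => {c B} [c + e|c B _ cB _ IH|c B -> //]; [rewrite e|rewrite (IH B)].
- case: cB c0 IH => {c B} [c + e|c B -> //|c B _ cB _ IH]; first by rewrite e.
  by congr bigcup; apply/funext => n; exact: IH.
Qed.

Lemma coded_codes (W : Type) (U : nat -> set W) c A :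
  codes U c A -> coded U c = A.
Proof.
move=> cA; rewrite predeqE => w; split=> [[B cB]|Aw]; last by exists A.
by rewrite (codes_unique cA cB).
Qed.

Lemma codes_coded (W : Type) (U : nat -> set W) c : BC U c -> codes U c (coded U c).
Proof. by move=> [A cA]; rewrite (coded_codes cA). Qed.

(** A code over a Polish space can be read over the Baire space by pulling the basis back along a
    parametrization. Evaluation is shown to be analytic only there. *)
Lemma codes_preimage (V W : Type) (U : nat -> set W) (L : V -> W) c A :
  codes U c A -> codes (fun n => L @^-1` U n) c (L @^-1` A).
Proof.
elim=> {c A} [c c0|c A c0 _ IH|c A c0 _ IH].
- exact: (@codes_basic _ (fun n => L @^-1` U n)).
- exact: codes_compl.
- rewrite preimage_bigcup; exact: codes_union.
Qed.

Lemma coded_preimage (V W : Type) (U : nat -> set W) (L : V -> W) c v :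
  BC U c -> coded (fun n => L @^-1` U n) c v <-> coded U c (L v).
Proof.
move=> /codes_coded cA; rewrite (coded_codes (codes_preimage L cA)).
by [].
Qed.

Lemma codes_borel (W : topologicalType) (U : nat -> set W) c A :
  (forall n, borel (U n)) -> codes U c A -> borel A.
Proof.
move=> bU; elim=> {c A} [c c0|c A c0 _ IH|c A c0 _ IH] //.
  exact: borelC.
exact: borel_bigcup.
Qed.

Fixpoint path_valid (c : Baire) (p : seq nat) : bool :=
  if p is l :: p' then valid c l && path_valid (child l c) p' else true.

Lemma path_valid_rcons c p l :
  path_valid c (rcons p l) = path_valid c p && valid (node c p) l.
Proof.
by elim: p c => [|k p IH] c /=; rewrite ?andbT// IH andbA.
Qed.

Lemma BC_node (W : Type) (U : nat -> set W) c p :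
  BC U c -> path_valid c p -> BC U (node c p).
Proof.
elim: p c => [//|l p IH] c Bc /= /andP[vl vp]; apply: IH => //.
by have [A cA] := Bc; exact: codes_child cA vl.
Qed.

(** * Truth assignments to the nodes of a code *)

Section Evaluation.
Variables (W : Type) (U : nat -> set W).

(* [h (pickle p)] is the truth value of membership of [x] in the set coded by
   the subcode of [c] at position [p]. *)
Definition eval_rules (c : Baire) (x : W) (h : Baire) : Prop :=
  forall p : seq nat, path_valid c p ->
  [/\ 2 <= node c p 0 -> (h (pickle p) = 1 <-> U (node c p 1) x),
      node c p 0 = 0 -> (h (pickle p) = 1 <-> h (pickle (rcons p 0)) <> 1) &
      node c p 0 = 1 ->
        (h (pickle p) = 1 <-> exists n, h (pickle (rcons p n.+1)) = 1)].

Definition evals (b : bool) (c : Baire) (x : W) : Prop :=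
  exists h, eval_rules c x h /\ (h (pickle (@nil nat)) = 1 <-> b).

Lemma eval_rules_codes c x h : eval_rules c x h ->
  forall d A, codes U d A ->
  forall p, path_valid c p -> node c p = d -> (h (pickle p) = 1 <-> A x).
Proof.
move=> hP d A; elim=> {d A} [d d0|d A d0 _ IH|d A d0 _ IH] p vp e;
    have [r2 r0 r1] := hP p vp.
- by rewrite e in r2; exact: r2.
- rewrite e in r0; apply: (iff_trans (r0 d0)).
  have := IH (rcons p 0); rewrite path_valid_rcons vp e /valid d0 node_rcons e.
  by move=> /(_ erefl erefl) H; split=> [n1 /H//|nA /H].
- rewrite e in r1; apply: (iff_trans (r1 d0)).
  have {}IH n : h (pickle (rcons p n.+1)) = 1 <-> A n x.
    by apply: IH; rewrite ?path_valid_rcons ?vp ?e /valid ?d0 ?node_rcons ?e.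
  by split=> [[n /IH]|[n _ /IH]]; exists n.
Qed.

Lemma eval_rules_exist c x : BC U c -> exists h, eval_rules c x h.
Proof.
move=> Bc; exists (fun k => if unpickle k is Some p
   then (if `[< coded U (node c p) x >] then 1 else 0) else 0) => p vp.
rewrite pickleK; have one (Q : Prop) : (if `[< Q >] then 1 else 0) = 1 <-> Q.
  by case: asboolP.
have [A cA] := BC_node Bc vp; rewrite (coded_codes cA).
move: cA; move E : (node c p) => d cA.
case: cA E => {d A} [d d0|d A d0 dA|d A d0 dA] E; split; rewrite ?d0//.
- by move=> e; rewrite e in d0.
- by move=> e; rewrite e in d0.
- move=> _; rewrite pickleK node_rcons E (coded_codes dA).
  by split=> [/one nA /one//|nA]; apply/one => Ax; apply: nA; apply/one.
- move=> _; split=> [/one[n _ An]|[n]].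
    by exists n; rewrite pickleK node_rcons E (coded_codes (dA n)); apply/one.
  rewrite pickleK node_rcons E (coded_codes (dA n)) => /one An.
  by apply/one; exists n.
Qed.

Lemma evalsT c x : BC U c -> evals true c x <-> coded U c x.
Proof.
move=> Bc; split=> [[h [hP h1]]|cx].
  by apply/(eval_rules_codes hP (codes_coded Bc) (p := [::]) erefl erefl); apply/h1.
have [h hP] := eval_rules_exist x Bc; exists h; split=> //; split=> // _.
exact/(eval_rules_codes hP (codes_coded Bc) (p := [::]) erefl erefl).
Qed.

Lemma evalsF c x : BC U c -> evals false c x <-> ~ coded U c x.
Proof.
move=> Bc; split=> [[h [hP h1]]|cx].
  by move=> cx; apply/notF/h1/(eval_rules_codes hP (codes_coded Bc) (p := [::]) erefl erefl).
have [h hP] := eval_rules_exist x Bc; exists h; split=> //; split=> //.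
by move/(eval_rules_codes hP (codes_coded Bc) (p := [::]) erefl erefl).
Qed.

End Evaluation.

Section SimpleCodes.
Variables (W : Type) (C : set (set W)) (lC : sigma_lattice C).

Lemma csimple_child l (c : W -> Baire) :
  csimple C c -> csimple C (fun w => child l (c w)).
Proof. by move=> sc m; case: l => [|l]; exact: sc. Qed.

Lemma csimple_node p (c : W -> Baire) :
  csimple C c -> csimple C (fun w => node (c w) p).
Proof.
by elim: p c => [//|l p IH] c sc /=; apply: IH; exact: csimple_child.
Qed.

Lemma simple_valid l (c : W -> Baire) :
  csimple C c -> simple C (fun w => valid (c w) l).
Proof.
by move=> sc; exact: (simple_comp lC (fun k => (k == 0) && (l == 0) || (k == 1) && (0 < l)) (sc 0)).
Qed.

Lemma simple_path_valid p (c : W -> Baire) :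
  csimple C c -> simple C (fun w => path_valid (c w) p).
Proof.
elim: p c => [|l p IH] c sc /=; first exact: simple_cst.
have sp := simple_pair lC (simple_valid l sc) (IH _ (csimple_child l sc)).
exact: (simple_comp lC (fun b : bool * bool => b.1 && b.2) sp).
Qed.

End SimpleCodes.

Lemma sigma11_notBC (W : Type) (U : nat -> set W) : sigma11 [set c | ~ BC U c].
Proof.
have -> : [set c | ~ BC U c] = [set c | exists q : Baire,
    forall n, valid (node c (mkseq q n)) (q n)].
  rewrite predeqE => c; split=> [nB|/acc_child_branch nA /BC_acc//].
  by apply/acc_child_branch => ac; apply: nB; apply/BC_acc.
apply: sigma11_ex; apply: borel_sigma11.
  exact: retract_baireM retract_baire_id retract_baire_id.
have lB := borel_lattice (Baire * Baire)%type.
have s1 : csimple (@borel (Baire * Baire)%type) fst.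
  by apply: borel_simple; apply: continuous_borel; exact: continuous_fst.
have s2 : csimple (@borel (Baire * Baire)%type) snd.
  by apply: borel_simple; apply: continuous_borel; exact: continuous_snd.
apply: borel_all => n; apply: (simple_pred lB (fun b => is_true b)).
apply: (simple_dep (f := fun p : Baire * Baire => (mkseq p.2 n, p.2 n))
  (g := fun t p => valid (node p.1 t.1) t.2)) => //.
  by apply: simple_pair => //; exact: simple_mkseq.
by move=> [p l] /=; apply: simple_valid => //; exact: csimple_node.
Qed.

Lemma sigma11_evals (U : nat -> set Baire) b :
  (forall n, borel (U n)) -> sigma11 [set p : Baire * Baire | evals U b p.1 p.2].
Proof.
move=> bU; apply: sigma11_ex; apply: borel_sigma11.
  by do 2?apply: retract_baireM; exact: retract_baire_id.
set X : topologicalType := (Baire * Baire * Baire)%type.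
have lB := borel_lattice X.
have cf : continuous (fun w : X => w.1.1).
  by apply: continuous_o; exact: continuous_fst.
have cx : continuous (fun w : X => w.1.2).
  by apply: continuous_o; [exact: continuous_fst|exact: continuous_snd].
have sc : csimple (@borel X) (fun w => w.1.1).
  by apply: borel_simple; exact: continuous_borel.
have sh : csimple (@borel X) (fun w => w.2).
  by apply: borel_simple; apply: continuous_borel; exact: continuous_snd.
have bh k (P : nat -> Prop) : borel [set w : X | P (w.2 k)].
  exact: (simple_pred lB).
have biff (A B : set X) : borel A -> borel B -> borel [set w | A w <-> B w].
  by move=> bA bB; apply: borelI; apply: borel_imply.
apply: borelI; last by apply: biff; [exact: (bh _ (fun i => i = 1))|exact: borel_const].
apply: borel_all => p; apply: borel_imply.
  by apply: (simple_pred lB (fun b => is_true b)); exact: simple_path_valid.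
have bn k (P : nat -> Prop) : borel [set w : X | P (node w.1.1 p k)].
  by apply: (simple_pred lB); apply: csimple_node.
have -> (A B D : set X) : (fun w => [/\ A w, B w & D w]) =
    [set w | A w /\ (B w /\ D w)].
  by rewrite predeqE => w; split=> [[]|[? []]].
apply: borelI; [|apply: borelI].
- apply: borel_imply; first exact: (bn 0 (fun i => 2 <= i)).
  apply: biff; first exact: (bh _ (fun i => i = 1)).
  have -> : (fun w : X => U (node w.1.1 p 1) w.1.2) =
      [set w | exists k, node w.1.1 p 1 = k /\ U k w.1.2].
    by rewrite predeqE => w; split=> [Uw|[k [<-]]//]; exists (node w.1.1 p 1).
  apply: borel_ex => k; apply: borelI; first exact: (bn 1 (fun i => i = k)).
  exact: (continuous_borel cx (bU k)).
- apply: borel_imply; first exact: (bn 0 (fun i => i = 0)).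
  by apply: biff; [exact: (bh _ (fun i => i = 1))|exact: (bh _ (fun i => i <> 1))].
- apply: borel_imply; first exact: (bn 0 (fun i => i = 1)).
  apply: biff; first exact: (bh _ (fun i => i = 1)).
  by apply: borel_ex => n; exact: (bh _ (fun i => i = 1)).
Qed.

(** * Countable bases and codes of sections *)

Lemma basis_open (W : topologicalType) (U : nat -> set W) n :
  basis (range U) -> open (U n).
Proof. by move=> [sU _]; apply: sU; exists n. Qed.

Lemma basis_nbhs (W : topologicalType) (U : nat -> set W) x (A : set W) :
  basis (range U) -> nbhs x A -> exists n, U n x /\ U n `<=` A.
Proof.
move=> [_ bU] nA; have [_ [[n _ <-] Ux] sA] := bU x _ nA.
by exists n.
Qed.

Lemma basisI (W : topologicalType) (U : nat -> set W) :
  (forall n, open (U n)) ->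
  (forall x (A : set W), nbhs x A -> exists n, U n x /\ U n `<=` A) ->
  basis (range U).
Proof.
move=> oU nU; split=> [_ [n _ <-]|x A /nU[n [Ux sA]]]; first exact: oU.
by exists (U n) => //; split=> //; exists n.
Qed.

Definition baire_basis (k : nat) : set Baire :=
  if unpickle k is Some s then cylinder s else set0.

Lemma basis_baire : basis (range baire_basis).
Proof.
apply: basisI => [n|x A].
  rewrite /baire_basis; case: unpickle => [s|]; first exact: open_cylinder.
  exact: open0.
rewrite nbhs_baireE => -[n An]; exists (pickle (mkseq x n)).
by rewrite /baire_basis pickleK /cylinder /= size_mkseq; split=> // y /= /An.
Qed.

Definition basic_code (k : nat) : Baire := fun m => if m is 0 then 2 else k.

Definition compl_code (c : Baire) : Baire := fun m => if m is n.+1 then c n else 0.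

(** Inverse of (n, m) |-> 2 ^ n * (2 * m + 1): the 2-adic valuation recovers [n], and halving the
    odd cofactor recovers [m]. Position 0 is free for the kind of the node. *)
Definition union_code (g : nat -> Baire) : Baire :=
  fun k => if k is 0 then 1 else g (logn 2 k) (k %/ 2 ^ logn 2 k)./2.

Lemma union_codeE g n : (fun m => union_code g (2 ^ n * m.*2.+1)) = g n.
Proof.
apply/funext => m; rewrite /union_code.
case E : (2 ^ n * m.*2.+1) => [|k].
  by have := expn_gt0 2 n; move: E => /eqP; rewrite muln_eq0 orbF => /eqP ->.
rewrite -E lognM ?expn_gt0// lognX logn_prime// muln1.
have -> : logn 2 m.*2.+1 = 0 by rewrite logn_coprime// coprime2n /= odd_double.
by rewrite addn0 mulKn ?expn_gt0// /= uphalf_double.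
Qed.

Section Codes.
Variables (W : Type) (U : nat -> set W).

Lemma codes_basic_code k : codes U (basic_code k) (U k).
Proof. exact: (@codes_basic _ U (basic_code k)). Qed.

Lemma codes_compl_code c A : codes U c A -> codes U (compl_code c) (~` A).
Proof. by move=> cA; apply: codes_compl. Qed.

Lemma codes_union_code g A :
  (forall n, codes U (g n) (A n)) -> codes U (union_code g) (\bigcup_n A n).
Proof. by move=> cA; apply: codes_union => // n; rewrite union_codeE. Qed.

End Codes.

Lemma csimple_union_code (W : Type) (C : set (set W)) (g : nat -> W -> Baire) :
  sigma_lattice C -> (forall n, csimple C (g n)) ->
  csimple C (fun w => union_code (g^~ w)).
Proof.
by move=> lC sg [|m]; [exact: simple_cst|exact: sg].
Qed.

(** A section of an open set is the union of the [U k] such that some rectangle [cylinder s] times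
    [U k] lies in [D], with [s] an initial segment of [v]. Whether a given pair (s, k) takes part
    depends on finitely many values of [v], so the code is continuous in [v]; complements and unions
    act on codes coordinatewise. *)
Lemma borel_section_codes (W : topologicalType) (U : nat -> set W)
    (D : set (Baire * W)%type) : basis (range U) -> borel D ->
  exists2 f : Baire -> Baire,
    continuous f & forall v, codes U (f v) [set w | D (v, w)].
Proof.
move=> bU; have lO := open_lattice Baire.
suff H : borel D -> exists2 f : Baire -> Baire, csimple (@open Baire) f &
    forall v, codes U (f v) [set w | D (v, w)].
  by move=> /H[f sf cf]; exists f => //; apply: continuous_baireP => m k; exact: sf.
(* The union has to list a code at every index, so the rejected pairs get a code of the empty set,
   namely the complement of the union of the whole basis. *)
pose full := union_code basic_code.
have cfull : codes U full setT.
  have -> : setT = \bigcup_n U n.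
    rewrite predeqE => w; split=> // _.
    by have [n [Uw _]] := basis_nbhs bU (filterT : nbhs w setT); exists n.
  by apply: codes_union_code => n; exact: codes_basic_code.
have cempty : codes U (compl_code full) set0.
  by rewrite -setCT; exact: codes_compl_code.
apply: (@borel_ind _ (fun D => exists2 f : Baire -> Baire,
    csimple (@open Baire) f & forall v, codes U (f v) [set w | D (v, w)])).
- move=> {}D oD.
  pose piece n v := if unpickle n is Some (s, k) then
    if `[< cylinder s v /\ forall v' w, cylinder s v' -> U k w -> D (v', w) >]
    then basic_code k else compl_code full else compl_code full.
  exists (fun v => union_code (piece^~ v)).
    apply: csimple_union_code => // n m; rewrite /piece.
    case: unpickle => [[s k]|]; last exact: simple_cst.
    apply: (simple_comp lO (fun t => (if `[< t = s /\ forall v' w, cylinder s v' -> U k w -> D (v', w) >]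
      then basic_code k else compl_code full) m)).
    apply: simple_mkseq => //; apply: continuous_simple; exact: continuous_id.
  move=> v; have -> : [set w | D (v, w)] = \bigcup_n
     (if unpickle n is Some (s, k) then
      if `[< cylinder s v /\ forall v' w, cylinder s v' -> U k w -> D (v', w) >]
      then U k else set0 else set0).
    rewrite predeqE => w; split=> [/= Dvw|[n _]].
      have [[P Q] [/= nP nQ] PQ] : nbhs (v, w) D by exact: open_nbhs_nbhs.
      rewrite nbhs_baireE in nP; have [n Pn] := nP.
      have [k [Uk kQ]] := basis_nbhs bU nQ.
      exists (pickle (mkseq v n, k)) => //; rewrite pickleK.
      case: asboolP => // -[]; split; first by rewrite /cylinder /= size_mkseq.
      rewrite /cylinder /= size_mkseq => v' w' /Pn Pv' /kQ Qw'.
      exact: (PQ (v', w')).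
    by case: unpickle => // -[s k]; case: asboolP => // -[vs H] Uw; exact: H.
  apply: codes_union_code => n; rewrite /piece; case: unpickle => // -[s k].
  by case: asboolP => // _; exact: codes_basic_code.
- move=> {}D [f sf cf]; exists (fun v => compl_code (f v)).
    by case=> [|m]; [exact: simple_cst|exact: sf].
  by move=> v; exact: codes_compl_code (cf v).
- move=> F H.
  have /choice[f fP] n : exists f : Baire -> Baire, csimple (@open Baire) f /\
      forall v, codes U (f v) [set w | F n (v, w)].
    by have [f] := H n; exists f.
  exists (fun v => union_code (f^~ v)).
    by apply: csimple_union_code => // n; exact: (fP n).1.
  move=> v; have -> : [set w | (\bigcup_n F n) (v, w)] =
      \bigcup_n [set w | F n (v, w)].
    by rewrite predeqE => w; split=> -[n _ Fn]; exists n.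
  by apply: codes_union_code => n; exact: (fP n).2.
Qed.

Lemma borel_codes (W : topologicalType) (U : nat -> set W) (A : set W) :
  basis (range U) -> borel A -> exists c, codes U c A.
Proof.
move=> bU bA; have [|f _ /(_ (fun=> 0)) cf] :=
    @borel_section_codes W U [set p | A p.2] bU.
  exact: (continuous_borel (@continuous_snd Baire W) bA).
by exists (f (fun=> 0)).
Qed.

(** * Codes of Borel functions *)

(* [psi e] takes its values in the Cantor space: its [m]-th bit is the
   indicator function of the set coded by the [m]-th column of [e]. *)
Definition psi (e x : Baire) : Baire :=
  fun m => if `[< coded baire_basis (col m e) x >] then 1 else 0.

Definition fun_code (e : Baire) : Prop := forall m, BC baire_basis (col m e).

Definition psi_graph (e x z : Baire) : Prop := forall m,
  (z m = 1 /\ evals baire_basis true (col m e) x) \/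
  (z m = 0 /\ evals baire_basis false (col m e) x).

Lemma psi_graphP e x z : fun_code e -> psi_graph e x z <-> z = psi e x.
Proof.
move=> fe; split=> [H|-> m]; last first.
  rewrite /psi; case: asboolP => cx; [left|right]; split=> //.
    by apply/evalsT => //; exact: fe.
  by apply/evalsF => //; exact: fe.
apply/funext => m; rewrite /psi; have [[-> /evalsT H']|[-> /evalsF H']] := H m.
  by case: asboolP => // -[]; apply: H'; exact: fe.
by case: asboolP => // cx; case: (H' (fe m)).
Qed.

Lemma sigma11_not_fun_code : sigma11 [set e | ~ fun_code e].
Proof.
have -> : [set e | ~ fun_code e] = [set e | exists m, ~ BC baire_basis (col m e)].
  by rewrite predeqE => e /=; rewrite -existsNP.
apply: sigma11_bigcup => m.
exact: (sigma11_preimage (@continuous_col m) (sigma11_notBC baire_basis)).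
Qed.

Lemma sigma11_psi_graph :
  sigma11 [set p : Baire * Baire * Baire | psi_graph p.1.1 p.1.2 p.2].
Proof.
pose X : topologicalType := (Baire * Baire * Baire)%type.
have bb n : borel (baire_basis n).
  by apply: open_borel; exact: basis_open basis_baire.
have rX : retract_baire X.
  by do 2?apply: retract_baireM; exact: retract_baire_id.
have ce m : continuous (fun p : X => (col m p.1.1, p.1.2)).
  apply: continuous_pair; last first.
    by apply: continuous_o; [exact: continuous_fst|exact: continuous_snd].
  apply: (@continuous_o _ _ _ (fun p : X => p.1.1)); last exact: continuous_col.
  by apply: continuous_o; exact: continuous_fst.
have sz m k : sigma11 [set p : X | p.2 m = k].
  by apply: borel_sigma11 => //; apply: open_borel; apply: continuous_coord;
     exact: continuous_snd.
apply: sigma11_bigcap => m; apply: sigma11U; (apply: sigma11I; first exact: sz).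
  exact: (sigma11_preimage (ce m) (sigma11_evals true bb)).
exact: (sigma11_preimage (ce m) (sigma11_evals false bb)).
Qed.

Lemma psi_borel (f : Baire -> Baire) : borel_fun f ->
  (forall x m, f x m = 0 \/ f x m = 1) ->
  exists2 e, fun_code e & forall x, psi e x = f x.
Proof.
move=> bf f01; have /choice[c cP] m : exists c,
    codes baire_basis c [set x | f x m = 1].
  by apply: borel_codes; [exact: basis_baire|exact: borel_coord].
exists (merge c) => [m|x].
  by rewrite col_merge; exists [set x | f x m = 1].
apply/funext => m; rewrite /psi col_merge (coded_codes (cP m)) /=.
by case: asboolP => [->//|]; case: (f01 x m).
Qed.

Lemma borel_psi e : fun_code e -> borel_fun (psi e).
Proof.
move=> fe; have bc m : borel (coded baire_basis (col m e)).
  apply: (codes_borel _ (codes_coded (fe m))) => n.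
  by apply: open_borel; exact: basis_open basis_baire.
apply: borel_baireP => m k.
have -> : [set x | psi e x m = k] =
    [set x | (coded baire_basis (col m e) x /\ k = 1) \/
             ((~` coded baire_basis (col m e)) x /\ k = 0)].
  rewrite predeqE => x /=; rewrite /psi /setC /=.
  by case: asboolP => cx; split=> [<-|[[]|[]]//]; [left|right].
by apply: borelU; apply: borelI => //; [exact: borel_const|exact: borelC|
  exact: borel_const].
Qed.

(** * Parametrizations of Polish spaces *)

Section Metric.
Import Order.TTheory GRing.Theory Num.Theory.
Local Open Scope ring_scope.
Variables (R : realType) (T : topologicalType) (d : T -> T -> R) (z : nat -> T).
Hypothesis d_eq0 : forall x y, d x y = 0 <-> x = y.
Hypothesis d_sym : forall x y, d x y = d y x.
Hypothesis d_tri : forall x y w, d x w <= d x y + d y w.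
Hypothesis d_nbhs : forall (x : T) (A : set T),
  nbhs x A <-> exists2 e : R, 0 < e & [set y | d x y < e] `<=` A.
Hypothesis d_complete : forall u : nat -> T,
  (forall e : R, 0 < e -> exists N : nat, forall m n : nat,
     (N <= m)%N -> (N <= n)%N -> d (u m) (u n) < e) ->
  exists l : T, u n @[n --> \oo] --> l.
Hypothesis z_dense : forall x e, 0 < e -> exists k, d (z k) x < e.

Let ball x e : set T := [set y | d x y < e].
Let h (n : nat) : R := 2^-1 ^+ n.

Let h_gt0 n : 0 < h n.
Proof. by rewrite exprn_gt0// invr_gt0. Qed.

Let hS n : h n.+1 + h n.+1 = h n.
Proof. by rewrite /h exprS; lra. Qed.

Let h_small e : 0 < e -> exists n, h n < e.
Proof.
move=> e0; exists (Num.bound e^-1).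
rewrite /h exprVn -[ltRHS]invrK ltf_pV2 ?posrE ?invr_gt0 ?exprn_gt0//.
apply: lt_le_trans (archi_boundP _) _; first by rewrite invr_ge0 ltW.
by rewrite -natrX ler_nat ltnW// ltn_expl.
Qed.

Let dxx x : d x x = 0. Proof. exact/d_eq0. Qed.

Let d_ge0 x y : 0 <= d x y.
Proof. by have := d_tri x y x; rewrite (d_sym y x) dxx; lra. Qed.

Let open_ball x e : open (ball x e).
Proof.
rewrite openE => y; rewrite /ball /= => xy.
apply/d_nbhs; exists (e - d x y); first lra.
by move=> w /= yw; have := d_tri x y w; rewrite /ball /=; lra.
Qed.

Let geometric_limit (u : nat -> T) : (forall n, d (u n) (u n.+1) <= h n) ->
  exists l, forall n, d (u n) l <= h n + h n.
Proof.
move=> hu; have ub n k : d (u n) (u (n + k)%N) <= h n + h n - (h (n + k)%N + h (n + k)%N).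
  elim: k => [|k IH]; first by rewrite addn0 dxx subrr.
  have := d_tri (u n) (u (n + k)%N) (u (n + k.+1)%N); rewrite addnS.
  by have := hu (n + k)%N; have := hS (n + k)%N; lra.
have ub' n k : d (u n) (u (n + k)%N) <= h n + h n.
  by have := ub n k; have := h_gt0 (n + k)%N; lra.
have [e e0|l ul] := d_complete (u := u).
  have [|N hN] := @h_small (e / 4); first lra.
  exists N => m n Nm Nn.
  have := ub' N (m - N)%N; have := ub' N (n - N)%N; rewrite !subnKC//.
  by have := d_tri (u m) (u N) (u n); rewrite (d_sym (u m) (u N)); lra.
exists l => n; apply/ler_addgt0Pr => e e0.
have /ul [N _ HN] : nbhs l (ball l e) by apply/d_nbhs; exists e.
have := HN (n + N)%N (leq_addl _ _); rewrite /ball /= d_sym => lN.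
by have := d_tri (u n) (u (n + N)%N) l; have := ub' n N; lra.
Qed.

Let small_eq x y : (forall n, d x y <= 4 * h n) -> x = y.
Proof.
move=> H; apply/d_eq0/eqP; rewrite eq_le d_ge0 andbT.
apply/ler_addgt0Pr => e e0; have [|n hn] := @h_small (e / 4); first lra.
by have := H n; lra.
Qed.

(** An entry is followed only if its point is within [h m] of the current one; otherwise the current
    index is repeated. So every sequence converges and the limit map is total, while a sequence that
    approximates fast enough is left unchanged. *)
Let Fixpoint idx (x : Baire) (n : nat) : nat :=
  if n is m.+1 then if d (z (idx x m)) (z (x n)) < h m then x n else idx x m
  else x 0%N.

Let idx_eq x y n : mkseq x n.+1 = mkseq y n.+1 -> idx x n = idx y n.
Proof.
elim: n => [|n IH] e /=; first exact: (mkseq_eq (ltnSn 0) e).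
by rewrite IH ?(mkseq_eq (ltnSn _) e)//; exact: mkseq_leq e.
Qed.

Let idx_step x n : d (z (idx x n)) (z (idx x n.+1)) <= h n.
Proof. by rewrite /=; case: ifP => [/ltW//|_]; rewrite dxx ltW. Qed.

Let first_near x e (e0 : 0 < e) : nat := ex_minn (z_dense x e0).

Lemma metric_param : exists (L : Baire -> T) (S : T -> Baire),
  [/\ continuous L, borel_fun S & cancel S L].
Proof.
have /choice[L LP] x : exists l, forall n, d (z (idx x n)) l <= h n + h n.
  exact: geometric_limit (idx_step x).
(* With radius [h n.+2], two consecutive approximations of [x] differ by less than
   [h n.+2 + h n.+3], which is below [h n], so [idx] never overrides them. *)
pose S x : Baire := fun n => first_near x (h_gt0 n.+2).
exists L, S; split.
- move=> x A /d_nbhs[e e0 sA]; rewrite /= nbhs_filterE nbhs_baireE.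
  have [|n hn] := @h_small (e / 4); first lra.
  exists n.+1 => y exy; apply: sA; rewrite /=.
  have := LP x n; have := LP y n; rewrite (idx_eq exy).
  by have := d_tri (L x) (z (idx x n)) (L y); rewrite (d_sym (L x) (z _)); lra.
- apply: borel_baireP => n k; pose e := h n.+2.
  have -> : [set x | S x n = k] = [set x | ball (z k) e x /\
      forall j : nat, (j < k)%N -> (~` ball (z j) e) x].
    rewrite predeqE => x; rewrite /S /first_near /=; case: ex_minnP => m zm mP.
    split=> [<-|[zk nk]].
      by split=> // j jm; rewrite /ball /setC /= => H; have := mP _ H; rewrite leqNgt jm.
    by apply/eqP; rewrite eqn_leq mP// leqNgt; apply/negP => /nk; exact.
  apply: borelI; first by apply: open_borel; exact: open_ball.
  apply: borel_all => j; apply: borel_imply; first exact: borel_const.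
  by apply: borelC; apply: open_borel; exact: open_ball.
- move=> x; have SP n : d (z (S x n)) x < h n.+2.
    by rewrite /S /first_near; case: ex_minnP.
  have idxS n : idx (S x) n = S x n.
    elim: n => [//|n IH]; rewrite [LHS]/= IH.
    have := SP n; have := SP n.+1; have := hS n; have := hS n.+1.
    have := hS n.+2; have := h_gt0 n; have := h_gt0 n.+3.
    have := d_tri (z (S x n)) x (z (S x n.+1)).
    rewrite (d_sym x (z _)) => ? ? ? ? ? ? ? ?.
    by rewrite (_ : d _ _ < h n)//; lra.
  apply: small_eq => n; have := LP (S x) n; rewrite idxS.
  have := SP n; have := hS n; have := hS n.+1; have := h_gt0 n.+2.
  by have := d_tri (L (S x)) (z (S x n)) x; rewrite (d_sym (L _) (z _)); lra.
Qed.

Let near_ball x e : 0 < e -> exists k n, ball (z k) (h n) x /\ ball (z k) (h n) `<=` ball x e.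
Proof.
move=> e0; have [|n hn] := @h_small (e / 2); first lra.
have [k zk] := z_dense x (h_gt0 n); exists k, n; split=> // y; rewrite /ball /= => zy.
by have := d_tri x (z k) y; rewrite (d_sym x (z k)); lra.
Qed.

Lemma metric_basis : exists U : nat -> set T, basis (range U).
Proof.
exists (fun i => if unpickle i is Some (k, n) then ball (z k) (h n) else set0).
apply: basisI => [i|x A /d_nbhs[e e0 sA]].
  by case: unpickle => [[k n]|]; [exact: open_ball|exact: open0].
have [k [n [xk kx]]] := near_ball x e0.
by exists (pickle (k, n)); rewrite pickleK; split=> // y /kx; exact: sA.
Qed.

Let big (p : T * R) : Prop := ~ countable (ball p.1 p.2).

(** Two distinct condensation points of the ball are surrounded by small balls. The closed new balls
    are required to lie inside the old one, so that a limit of centres stays in every ball along its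
    branch. *)
Let big_split (p : T * R) (eta : R) : 0 < eta -> big p ->
  exists q0 q1 : T * R, [/\ big q0, big q1,
    0 < q0.2 < eta /\ 0 < q1.2 < eta,
    forall y, d q0.1 y <= q0.2 \/ d q1.1 y <= q1.2 -> ball p.1 p.2 y &
    forall y, ball q0.1 q0.2 y -> ball q1.1 q1.2 y -> False].
Proof.
case: p => x e eta0; rewrite /big /= => bx.
(* Condensation points. The other points of the ball are covered by the countably many countable
   balls of [thin], so with at most one condensation point the ball would be countable. *)
pose cond := [set y | ball x e y /\ forall r, 0 < r -> ~ countable (ball y r)].
pose thin : set T := \bigcup_(i in [set i : nat * nat | countable (ball (z i.1) (h i.2))])
  ball (z i.1) (h i.2).
have cthin : countable thin by apply: bigcup_countable => //; exact: countableP.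
have cover : ball x e `<=` thin `|` cond.
  move=> y xy; have [[r r0 cr]|nr] := pselect (exists2 r, 0 < r & countable (ball y r)).
    left; have [k [n [yk ky]]] := near_ball y r0; exists (k, n) => //=.
    by apply: sub_countable cr; apply: subset_card_le.
  by right; split=> // r r0 cr; apply: nr; exists r.
have [x0 [x1 [c0 c1 n01]]] : exists x0 x1, [/\ cond x0, cond x1 & x0 <> x1].
  apply: contrapT => nc; apply: bx; have [[x0 c0]|nx] := pselect (exists x0, cond x0).
    have sub : ball x e `<=` \bigcup_(b in [set: bool]) (if b then thin else [set x0]).
      move=> y /cover[ty|cy]; first by exists true.
      exists false => //=; apply: contrapT => ny; apply: nc; exists x0, y.
      by split=> // e0; exact: ny.
    apply: sub_countable (subset_card_le sub) _; apply: bigcup_countable.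
      exact: countableP.
    by case=> _ //; exact: countable1.
  apply: sub_countable cthin; apply: subset_card_le => y /cover[//|cy].
  by case: nx; exists y.
have r0 : 0 < d x0 x1.
  by rewrite lt_neqAle d_ge0 andbT eq_sym; apply/eqP => /d_eq0.
have [[x0e b0] [x1e b1]] := (c0, c1); rewrite /ball /= in x0e x1e.
(* The radius has to be below [eta], below half the distance of the centres for disjointness, and
   below their distances to the boundary sphere for nesting. *)
pose m := Num.min (Num.min eta (d x0 x1 / 2)) (Num.min (e - d x x0) (e - d x x1)).
have [|n] := @h_small m.
  by rewrite !lt_min eta0 /= !subr_gt0 x0e x1e andbT; lra.
rewrite !lt_min => /andP[/andP[n1 n2] /andP[n3 n4]].
exists (x0, h n), (x1, h n); split=> /=.
- exact: b0.
- exact: b1.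
- by rewrite h_gt0.
- move=> y H; rewrite /ball /=.
  have [H0 | H1] := H.
    by have := d_tri x x0 y; lra.
  by have := d_tri x x1 y; lra.
- move=> y; rewrite /ball /= => y0 y1.
  by have := d_tri x0 y x1; rewrite (d_sym y x1); lra.
Qed.

(* A Cantor scheme of balls gives a continuous map from the Cantor space; a
   point in its range is decoded by looking at the balls that contain it. *)
Lemma metric_perfect : ~ countable [set: T] ->
  exists (f : Baire -> T) (g : T -> Baire), [/\ continuous f, borel_fun g &
    forall x : Baire, (forall n, x n = 0%N \/ x n = 1%N) -> g (f x) = x].
Proof.
move=> ncT; pose S := {p : T * R | big p}.
have [k bk] : exists k, big (z k, h 0).
  apply: contrapT => nk; apply: ncT.
  have sub : [set: T] `<=` \bigcup_(k in [set: nat]) ball (z k) (h 0).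
    by move=> y _; have [k ky] := z_dense y (h_gt0 0); exists k.
  apply: sub_countable (subset_card_le sub) _; apply: bigcup_countable; first exact: countableP.
  move=> k _.
  by apply: contrapT => nc; apply: nk; exists k.
have /choice[st stP] (pn : S * nat) : exists q : S * S, [/\
    0 < (sval q.1).2 < h pn.2, 0 < (sval q.2).2 < h pn.2,
    forall y, d (sval q.1).1 y <= (sval q.1).2 \/ d (sval q.2).1 y <= (sval q.2).2 ->
      ball (sval pn.1).1 (sval pn.1).2 y &
    forall y, ball (sval q.1).1 (sval q.1).2 y ->
      ball (sval q.2).1 (sval q.2).2 y -> False].
  case: pn => -[p bp] n; have [q0 [q1 [b0 b1 [e0 e1] sub disj]]] := big_split (h_gt0 n) bp.
  by exists (exist _ q0 b0, exist _ q1 b1).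
(* The newest bit is at the head of [s], which is why [br] below reverses initial segments; the
   length of the sequence supplies the bound on the next radius. *)
pose fix sc (s : seq bool) : S := if s is b :: s' then
  let q := st (sc s', size s') in if b then q.2 else q.1 else exist _ (z k, h 0) bk.
pose cen s := (sval (sc s)).1; pose rad s := (sval (sc s)).2.
pose bl s := ball (cen s) (rad s).
have radP b s : 0 < rad (b :: s) < h (size s).
  by rewrite /rad /=; have [? ? _ _] := stP (sc s, size s); case: b.
have nest b s y : d (cen (b :: s)) y <= rad (b :: s) -> bl s y.
  rewrite /cen /rad /bl /=; have [_ _ H _] := stP (sc s, size s).
  by case: b => H'; apply: H; [right|left].
have nest' b s y : bl (b :: s) y -> bl s y by move=> /ltW; exact: nest.
have disj y s t : size s = size t -> bl s y -> bl t y -> s = t.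
  elim: s t => [|b s IH] [|c t]//= [est] ys yt.
  have e := IH t est (nest' _ _ _ ys) (nest' _ _ _ yt); rewrite -e in yt *.
  congr cons; have [_ _ _ H] := stP (sc s, size s).
  move: ys yt; rewrite /bl /cen /rad /=; case: b; case: c => // ys yt.
    by case: (H y).
  by case: (H y).
pose br (x : Baire) n := rev (mkseq (fun m => x m == 1%N) n).
have brS x n : br x n.+1 = (x n == 1%N) :: br x n by rewrite /br mkseqS rev_rcons.
have sbr x n : size (br x n) = n by rewrite /br size_rev size_mkseq.
have cen0 s : 0 <= rad s -> d (cen s) (cen s) <= rad s by rewrite dxx.
have rad0 b s : 0 <= rad (b :: s) by have /andP[/ltW] := radP b s.
have /choice[f fP] x : exists l, forall n, d (cen (br x n.+1)) l <= h n + h n.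
  apply: geometric_limit => n.
  have : bl (br x n.+1) (cen (br x n.+2)).
    by rewrite [in X in cen X]brS; apply: (@nest (x n.+1 == 1%N)); rewrite cen0.
  rewrite /bl /ball /= => H; apply: ltW; apply: lt_trans H _.
  by rewrite brS; have /andP[_] := radP (x n == 1%N) (br x n); rewrite sbr.
have nests x n i y : bl (br x (n + i)%N) y -> bl (br x n) y.
  by elim: i => [|i IH]; rewrite ?addn0// addnS brS => /nest'/IH.
have fbl x n : bl (br x n) (f x).
  suff : d (cen (br x n.+1)) (f x) <= rad (br x n.+1).
    by rewrite brS; exact: nest.
  apply/ler_addgt0Pr => e e0; have [|i hi] := @h_small (e / 2); first lra.
  have ci : bl (br x n.+1) (cen (br x (n.+1 + i)%N)).
    apply: (@nests _ _ i); rewrite /bl /ball /= dxx addSn brS.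
    by have /andP[] := radP (x (n + i)%N == 1%N) (br x (n + i)%N).
  have := fP x (n + i)%N; rewrite -addSn; move: ci; rewrite /bl /ball /=.
  have : h (n + i)%N <= h i.
    rewrite /h exprD ler_piMl ?exprn_ge0 ?invr_ge0// exprn_ile1 ?invr_ge0//.
    by rewrite invf_le1// ler1n.
  by have := d_tri (cen (br x n.+1)) (cen (br x (n.+1 + i)%N)) (f x); lra.
(* Balls of one level are disjoint, so bit [n] of [x] is found by asking whether [f x] lies in some
   ball of level [n.+1] with newest bit [true]. The question makes sense for every point, so the
   decoding is total. *)
exists f, (fun y n => if `[< exists s, size s = n /\ bl (true :: s) y >] then 1%N else 0%N).
split.
- move=> x A /d_nbhs[e e0 sA]; rewrite /= nbhs_filterE nbhs_baireE.
  have [|n hn] := @h_small (e / 4); first lra.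
  exists n.+1 => y exy; apply: sA; rewrite /=.
  have := fP x n; have := fP y n.
  have -> : br y n.+1 = br x n.+1.
    rewrite /br; congr rev; apply: eq_mkseqP => m mn; by rewrite (mkseq_eq mn exy).
  have := d_tri (f x) (cen (br x n.+1)) (f y); rewrite (d_sym (f x) (cen _)).
  by lra.
- apply: borel_baireP => n m; pose A := [set y | exists s, size s = n /\ bl (true :: s) y].
  have oA : borel A.
    by apply: borel_ex => s; apply: borelI; [exact: borel_const|
      apply: open_borel; exact: open_ball].
  have -> : [set y | (if `[< exists s, size s = n /\ bl (true :: s) y >] then 1 else 0)%N = m] =
      [set y | (A y /\ m = 1%N) \/ ((~` A) y /\ m = 0%N)].
    rewrite predeqE => y /=; case: asboolP => Ay; split=> [<-|[[]|[]]//];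
      [by left|by right].
  by apply: borelU; apply: borelI => //; [exact: borel_const|exact: borelC|
    exact: borel_const].
- move=> x x01; apply/funext => n; case: asboolP => [[s [sn sx]]|ns].
    have := @disj (f x) (true :: s) (br x n.+1); rewrite sbr /= sn => /(_ erefl sx (fbl x n.+1)).
    by rewrite brS => -[+ _]; case: (x01 n) => ->.
  case: (x01 n) => // xn; case: ns; exists (br x n); split; first exact: sbr.
  by have := fbl x n.+1; rewrite brS xn eqxx.
Qed.

End Metric.

Section Polish.
Variables (R : realType) (T : topologicalType) (pT : polish R T) (t0 : T).

Let dense_seq (S : set T) : countable S -> dense S ->
  exists z : nat -> T, forall O : set T, O !=set0 -> open O -> exists k, O (z k).
Proof.
move=> /countable_injP[f finj] dS.
pose z k := if pselect (exists2 s, S s & f s = k) is left ex then sval (cid2 ex) else t0.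
exists z => O O0 oO; have [s [Os Ss]] := dS O O0 oO; exists (f s).
rewrite /z; case: pselect => [ex|[]]; last by exists s.
case: (cid2 ex) => s' Ss' /= ss'; suff -> : s' = s by [].
by apply: finj; rewrite ?inE.
Qed.

Lemma polish_dense : exists (d : T -> T -> R) (z : nat -> T),
  [/\ forall x y, d x y = 0%R <-> x = y, forall x y, d x y = d y x,
      forall x y w, (d x w <= d x y + d y w)%R,
      forall (x : T) (A : set T),
        nbhs x A <-> exists2 e : R, (0 < e)%R & [set y | (d x y < e)%R] `<=` A &
      (forall u : nat -> T,
        (forall e : R, (0 < e)%R -> exists N : nat, forall m n : nat,
          (N <= m)%N -> (N <= n)%N -> (d (u m) (u n) < e)%R) ->
        exists l : T, u n @[n --> \oo] --> l) /\
      (forall x e, (0 < e)%R -> exists k, (d (z k) x < e)%R)].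
Proof.
have [[S cS dS] [d [d0 ds dt dn dc]]] := pT; have [z zP] := dense_seq cS dS.
exists d, z; split=> //; split=> // x e e0.
have nx : nbhs x [set y | (d x y < e)%R] by apply/dn; exists e.
have [||k zk] := zP ([set y | (d x y < e)%R]^°).
- by exists x; exact: nx.
- exact: open_interior.
by exists k; rewrite ds; exact: (interior_subset zk).
Qed.

Lemma polish_param : exists (L : Baire -> T) (S : T -> Baire),
  [/\ continuous L, borel_fun S & cancel S L].
Proof.
have [d [z [d0 ds dt dn [dc dz]]]] := polish_dense.
exact: (metric_param d0 ds dt dn dc dz).
Qed.

Lemma polish_basis : exists U : nat -> set T, basis (range U).
Proof.
have [d [z [d0 ds dt dn [dc dz]]]] := polish_dense.
exact: (metric_basis ds dt dn dz).
Qed.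

Lemma polish_perfect : ~ countable [set: T] ->
  exists (f : Baire -> T) (g : T -> Baire), [/\ continuous f, borel_fun g &
    forall x : Baire, (forall n, x n = 0 \/ x n = 1) -> g (f x) = x].
Proof.
have [d [z [d0 ds dt dn [dc dz]]]] := polish_dense.
exact: (metric_perfect d0 ds dt dn dc dz).
Qed.

End Polish.

(** * Zero-dimensional spaces *)

(** The clopen basis may be uncountable, but a countable one hides in it: for every pair of basic
    sets with a clopen set in between, one such set is chosen. The indicators of the chosen sets are
    the coordinates of [j]. *)
Lemma zero_dim_embedding (R : realType) (V : topologicalType) :
  polish R V -> zero_dim V ->
  exists2 j : V -> Baire, continuous j &
    forall v (A : set V), nbhs v A ->
    exists n, forall v', mkseq (j v') n = mkseq (j v) n -> A v'.
Proof.
move=> pV zV; have [[v0 _]|nV] := pselect (exists v : V, True); last first.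
  by exists (fun=> (fun=> 0)) => [v|v]; case: nV; exists v.
have [U bU] := polish_basis pV v0.
have /choice[C CP] (k : nat * nat) : exists C : set V, clopen C /\
    ((exists C', [/\ clopen C', U k.1 `<=` C' & C' `<=` U k.2]) ->
     U k.1 `<=` C /\ C `<=` U k.2).
  have [[C [cC C1 C2]]|nC] := pselect (exists C', [/\ clopen C', U k.1 `<=` C' & C' `<=` U k.2]).
    by exists C.
  (* Filler for the pairs without a clopen set in between. *)
  by exists setT; split=> //; split; [exact: openT|exact: closedT].
exists (fun v => fun k => if unpickle k is Some p then
    if `[< C p v >] then 1 else 0 else 0).
  apply: continuous_baireP => m k; case: unpickle => [p|]; last first.
    exact: (simple_cst (open_lattice V)).
  have [[oC cC] _] := CP p.
  have -> : [set v | (if `[< C p v >] then 1 else 0) = k] =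
      (C p `&` [set _ | k = 1]) `|` (~` C p `&` [set _ | k = 0]).
    rewrite predeqE => v; rewrite /=; case: asboolP => Cv; split.
    - by move=> <-; left.
    - by move=> [[_ ->]|[]].
    - by move=> <-; right.
    - by move=> [[]|[_ ->]].
  have oc (P : Prop) : open [set _ : V | P].
    have [p'|np] := pselect P.
      by rewrite (_ : [set _ | P] = setT) ?predeqE//; exact: openT.
    by rewrite (_ : [set _ | P] = set0) ?predeqE//; exact: open0.
  by apply: openU; apply: openI => //; rewrite openC.
move=> v A nA; have [m [vm mA]] := basis_nbhs bU nA.
have nm : nbhs v (U m).
  by apply: open_nbhs_nbhs; split=> //; exact: basis_open bU.
have [C' [cC' C'v] C'm] := zV.2 v _ nm.
have nC' : nbhs v C' by apply: open_nbhs_nbhs; split=> //; case: cC'.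
have [n [vn nC]] := basis_nbhs bU nC'.
have [_ [|Cn Cm]] := CP (n, m); first by exists C'.
exists (pickle (n, m)).+1 => v' /(mkseq_eq (ltnSn _)); rewrite pickleK.
by case: asboolP => [/Cm/mA//|_]; case: asboolP => // -[]; exact: Cn.
Qed.

(** [T] consists of the initial segments, seen through [j], of the points of a closed set projecting
    onto the complement of the co-analytic set. A branch over (v, a) yields a point of that closed
    set because initial segments of [j v] control all neighbourhoods of [v]. *)
Lemma sigma12_tree (R : realType) (V : topologicalType) (B : set V) :
  polish R V -> zero_dim V -> sigma12 B ->
  exists (j : V -> Baire) (T : seq nat -> seq nat -> seq nat -> Prop),
    [/\ continuous j,
        forall x a u k,
          T (mkseq x (size u).+1) (mkseq a (size u).+1) (rcons u k) ->
          T (mkseq x (size u)) (mkseq a (size u)) u &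
        forall v, B v <-> exists a : Baire,
          ~ exists b : Baire, forall n, T (mkseq (j v) n) (mkseq a n) (mkseq b n)].
Proof.
move=> pV zV [P [F cF eF] eB]; have [j cj jP] := zero_dim_embedding pV zV.
exists j, (fun s t u => exists v a b, [/\ F ((v, a), b), mkseq (j v) (size s) = s,
  mkseq a (size t) = t & mkseq b (size u) = u]); split=> //.
  move=> x a u k [v [a' [b []]]]; rewrite !size_mkseq size_rcons => Fb ej ea eb.
  exists v, a', b; split=> //.
  - exact: mkseq_leq ej.
  - exact: mkseq_leq ea.
  - by move: eb; rewrite mkseqS => /rcons_inj[].
have FT v (a b : Baire) : F ((v, a), b) <-> forall n, exists v' a' b',
    [/\ F ((v', a'), b'), mkseq (j v') (size (mkseq (j v) n)) = mkseq (j v) n,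
    mkseq a' (size (mkseq a n)) = mkseq a n & mkseq b' (size (mkseq b n)) = mkseq b n].
  split=> [Fb n|H]; first by exists v, a, b; rewrite !size_mkseq.
  apply: cF => A [[P1 P2] [/= [[P3 P4] [/= n3 n4] P34]]]; rewrite nbhs_baireE => -[n2 N2] PA.
  have [n3' N3] := jP _ _ n3; rewrite nbhs_baireE in n4; have [n4' N4] := n4.
  have [v' [a' [b' []]]] := H (maxn n2 (maxn n3' n4')); rewrite !size_mkseq => F' ej ea eb.
  exists ((v', a'), b'); split=> //; apply: PA; split=> /=.
    apply: P34; split=> /=.
      by apply: N3; apply: mkseq_leq ej; lia.
    by apply: N4; apply: mkseq_leq ea; lia.
  by apply: N2; apply: mkseq_leq eb; lia.
move=> v; rewrite eB; split=> [[[v' a] /= Pa <-]|[a na]].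
  exists a => -[b /FT Fb]; have : (~` P) (v', a) by rewrite eF; exists ((v', a), b).
  exact.
exists (v, a) => //; apply: contrapT => nP; apply: na.
have : (~` P) (v, a) by [].
by rewrite eF => -[[va b] /= Fb e]; exists b; apply/FT; rewrite -e.
Qed.

(* [0] if there is no such number. *)
Definition least (P : nat -> Prop) : nat :=
  if pselect (exists m, `[< P m >]) is left ex then ex_minn ex else 0.

Lemma leastP P : (exists m, P m) -> P (least P).
Proof.
move=> [m Pm]; rewrite /least; case: pselect => [ex|[]]; last by exists m; apply/asboolP.
by case: ex_minnP => k /asboolP.
Qed.

Lemma simple_least (W : topologicalType) (P : W -> nat -> Prop) :
  (forall m, borel [set w | P w m]) -> simple (@borel W) (fun w => least (P w)).
Proof.
move=> bP k; have -> : [set w | least (P w) = k] =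
    [set w | (P w k /\ forall j : nat, j < k -> ~ P w j) \/
             ((forall j : nat, ~ P w j) /\ k = 0)].
  rewrite predeqE => w; rewrite /least /=; case: pselect => [ex|nex].
    case: ex_minnP => m /asboolP Pm mP; split=> [<-|].
      by left; split=> // j jm /asboolP/mP; rewrite leqNgt jm.
    move=> [[/asboolP Pk nk]|[/(_ m)//]]; apply/eqP; rewrite eqn_leq mP//= leqNgt.
    by apply/negP => /nk.
  split=> [<-|[[/asboolP Pk]|[_ ->//]]]; last by case: nex; exists k.
  by right; split=> // j /asboolP Pj; apply: nex; exists j.
apply: borelU; apply: borelI; [exact: bP| | |exact: borel_const].
  apply: borel_all => j; apply: borel_imply; first exact: borel_const.
  exact: (borelC (bP j)).
by apply: borel_all => j; exact: (borelC (bP j)).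
Qed.

(** * Binary encodings *)

(** The characteristic function of the graph of [x]. Bits are what [psi] can produce and what the
    Cantor scheme can carry. *)
Definition encode (x : Baire) : Baire :=
  fun m => if unpickle m is Some (n, k) then (x n == k : nat) else 0.

Definition decode (x : Baire) : Baire :=
  fun n => least (fun k => x (pickle (n, k)) = 1).

Lemma encode01 x m : encode x m = 0 \/ encode x m = 1.
Proof. by rewrite /encode; case: unpickle => [[n k]|]; [case: eqP|]; auto. Qed.

Lemma encodeK : cancel encode decode.
Proof.
move=> x; apply/funext => n; rewrite /decode.
have H k : encode x (pickle (n, k)) = 1 -> x n = k.
  by rewrite /encode pickleK; case: eqP.
apply/esym; apply: H; apply: (leastP (P := fun k => encode x (pickle (n, k)) = 1)).
exists (x n).
by rewrite /encode pickleK eqxx.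
Qed.

Lemma continuous_encode : continuous encode.
Proof.
have lO := open_lattice Baire; apply: continuous_baireP => m.
rewrite /encode; case: unpickle => [[n k]|]; last exact: (simple_cst lO).
have s : simple (@open Baire) (fun x => x n).
  exact: (continuous_simple (@continuous_id Baire)).
exact: (simple_comp lO (fun i : nat => (i == k : nat)) s).
Qed.

Lemma borel_decode : borel_fun decode.
Proof.
apply: borel_baireP => n.
have H := @simple_least Baire (fun x k => x (pickle (n, k)) = 1).
apply: H => k.
exact: (@borel_coord Baire id _ 1 (continuous_borel (@continuous_id Baire))).
Qed.

(** * Tuples *)

Definition arity_nat (a : arity) : arity_index a -> nat :=
  match a with Fin n => fun j : 'I_n => nat_of_ord j | Omega => id end.

Definition tuple_code (a : arity) : (arity_index a -> Baire) -> Baire :=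
  match a with
  | Fin n => fun w : 'I_n -> Baire =>
      merge (fun k => if insub k is Some j then w j else fun=> 0)
  | Omega => merge
  end.

Lemma col_tuple_code a (w : arity_index a -> Baire) j :
  col (arity_nat j) (tuple_code w) = w j.
Proof.
case: a w j => [n|] w j /=; rewrite col_merge//.
by case: insubP => [i _ /val_inj ->//|]; rewrite ltn_ord.
Qed.

Lemma csimple_tuple_code (W : Type) (C : set (set W)) a
    (f : arity_index a -> W -> Baire) :
  sigma_lattice C -> (forall j, csimple C (f j)) ->
  csimple C (fun w => tuple_code (f^~ w)).
Proof.
move=> lC; case: a f => [n|] f sf; apply: csimple_merge => // k.
by case: insub => [j|]//= m; exact: simple_cst.
Qed.

Lemma borel_all_arity (W : topologicalType) a (F : arity_index a -> W -> Prop) :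
  (forall j, borel (F j)) -> borel [set w | forall j, F j w].
Proof. by case: a F => [n|] F; exact: borel_all. Qed.

Lemma sigma11_all_arity (W : topologicalType) a (F : arity_index a -> W -> Prop) :
  (forall j, sigma11 (F j)) -> sigma11 [set w | forall j, F j w].
Proof. by case: a F => [n|] F; exact: sigma11_allC. Qed.

Definition tuple_map (Y : topologicalType) a (L : Baire -> Y) (q : Baire) :
    power Y a :=
  fun j => L (col (arity_nat j) q).

Lemma tuple_map_code (Y : topologicalType) a (L : Baire -> Y) (S : Y -> Baire)
    (p : power Y a) :
  cancel S L -> tuple_map L (tuple_code (S \o p)) = p.
Proof.
by move=> SL; apply/funext => j; rewrite /tuple_map col_tuple_code /= SL.
Qed.

Lemma continuous_tuple_map (Y : topologicalType) a (L : Baire -> Y) :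
  continuous L -> continuous (tuple_map L : Baire -> power Y a).
Proof.
move=> cL; apply: continuous_ptws => j.
exact: continuous_o (@continuous_col _) cL.
Qed.

Lemma borel_tuple_code (W Y : topologicalType) a (S : Y -> Baire)
    (p : W -> power Y a) :
  continuous p -> borel_fun S -> borel_fun (fun w => tuple_code (S \o p w)).
Proof.
move=> cp bS; apply: borel_baireP => m k.
have lB := borel_lattice W.
apply: (csimple_tuple_code (f := fun j w => S (p w j)) lB) => j.
apply: borel_simple; apply: borel_comp bS; apply: continuous_borel.
exact: continuous_o cp (@eval_continuous _ Y j).
Qed.

(** * Restrictions to subspaces *)

Lemma borel_val (Y : topologicalType) (B : set Y) :
  borel_fun (val : set_type B -> Y).
Proof. apply: continuous_borel; exact: initial_continuous. Qed.

Lemma borel_subspace (Y : topologicalType) (B : set Y) (A : set (set_type B)) :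
  borel A -> exists2 A' : set Y, borel A' & A = (val : set_type B -> Y) @^-1` A'.
Proof.
move: A; apply: borel_ind.
- by move=> A [A' oA' <-]; exists A' => //; exact: open_borel.
- by move=> A [A' bA' ->]; exists (~` A') => //; exact: borelC.
- move=> F H; have /choice[A' AP] n : exists A' : set Y,
      borel A' /\ F n = (val : set_type B -> Y) @^-1` A'.
    by have [A' ? ?] := H n; exists A'.
  exists (\bigcup_n A' n); first by apply: borel_bigcup => n; have [] := AP n.
  rewrite preimage_bigcup; congr bigcup; apply/funext => n.
  by have [] := AP n.
Qed.

Lemma borel_if (S Z : topologicalType) (B : set S) (f g : S -> Z) :
  borel B -> borel_fun f -> borel_fun g ->
  borel_fun (fun s => if `[< B s >] then f s else g s).
Proof.
move=> bB bf bg A bA.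
have -> : (fun s => if `[< B s >] then f s else g s) @^-1` A =
    [set s | (B s /\ (f @^-1` A) s) \/ ((~` B) s /\ (g @^-1` A) s)].
  rewrite predeqE => s; rewrite /preimage /setC /=; case: asboolP => Bs.
    by split=> [|[[]|[]]//]; left.
  by split=> [|[[]|[]]//]; right.
by apply: borelU; apply: borelI; [|exact: bf|exact: borelC|exact: bg].
Qed.

Lemma borel_extend (Y Z : topologicalType) (B : set Y) (phi : set_type B -> Z)
    (z0 : Z) : borel B -> borel_fun phi ->
  exists2 f : Y -> Z, borel_fun f & forall x, f (val x) = phi x.
Proof.
move=> bB bphi.
pose f y := if pselect (B y) is left By then phi (exist _ y (mem_set By)) else z0.
exists f => [A /[dup] bA /bphi/borel_subspace[A' bA' eA]|x]; last first.
  rewrite /f; case: pselect => [Bx|[]]; last exact: (set_mem (valP x)).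
  by congr phi; exact: val_inj.
have -> : f @^-1` A = [set y | (B y /\ A' y) \/ ((~` B) y /\ A z0)].
  rewrite predeqE => y; rewrite /f /preimage /setC /=; case: pselect => By.
    have := congr1 (fun S => S (exist _ y (mem_set By))) eA.
    by rewrite /preimage /= => ->; split=> [|[[]|[]]//]; left.
  by split=> [|[[]|[]]//]; right.
apply: borelU; apply: borelI => //; [exact: borelC|exact: borel_const].
Qed.

(** Eliminates the subspace type: a Borel map on the Borel set [B] extends by the constant [z0], and
    only tuples from [B] are tested. *)
Lemma admits_restrP (I : Type) (r : I -> arity) (Y Z : topologicalType)
    (B : set Y) (G : structure r Y) (H : structure r Z) (z0 : Z) : borel B ->
  admits_borel_hom (restr_structure B G) H <->
  exists2 phi : Y -> Z, borel_fun phi & forall i (p : power Y (r i)),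
    (forall j, B (p j)) -> G i p -> H i (fun j => phi (p j)).
Proof.
move=> bB; split=> [[phi bphi hphi]|[phi bphi hphi]].
  have [f bf fE] := borel_extend z0 bB bphi; exists f => // i p Bp Gp.
  pose p' : power (set_type B) (r i) := fun j => exist _ (p j) (mem_set (Bp j)).
  have := hphi i p' Gp; congr (H i _); apply/funext => j.
  by rewrite -fE.
exists (phi \o val).
  exact: borel_comp (@borel_val Y B) bphi.
move=> i p Gp; apply: (hphi i (fun j => val (p j))) => // j.
exact: (set_mem (valP (p j))).
Qed.

Lemma borel_eq_baire (W : topologicalType) (f g : W -> Baire) :
  borel_fun f -> borel_fun g -> borel [set w | f w = g w].
Proof.
move=> bf bg; have -> : [set w | f w = g w] =
    [set w | forall m, exists k, f w m = k /\ g w m = k].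
  rewrite predeqE => w; split=> [/= e m|H]; first by exists (g w m); rewrite e.
  by apply/funext => m; have [k [-> ->]] := H m.
apply: borel_all => m; apply: borel_ex => k.
by apply: borelI; exact: borel_coord.
Qed.

Lemma sigma12_preimage (V W : topologicalType) (f : V -> W) (A : set W) :
  continuous f -> sigma12 A -> sigma12 [set v | A (f v)].
Proof.
move=> cf [F pF eA]; exists [set p | F (f p.1, p.2)]; last first.
  rewrite predeqE => v; split=> /= [|[[v' e] /= Fv <-]]; rewrite eA.
    by move=> [[w e] /= Fw ew]; exists (v, e) => //=; rewrite -ew.
  by exists (f v', e).
have cp : continuous (fun p : V * Baire => (f p.1, p.2)).
  apply: continuous_pair; last exact: continuous_snd.
  exact: continuous_o (@continuous_fst V Baire) cf.
exact: (sigma11_preimage cp pF).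
Qed.

(** * The upper bound *)

Section UpperBound.
Variables (I : countType) (r : I -> arity) (Z : topologicalType).
Variables (H : structure r Z) (borelH : borel_structure H).
Arguments H : clear implicits.
Variables (LZ : Baire -> Z) (SZ : Z -> Baire).
Hypotheses (cLZ : continuous LZ) (bSZ : borel_fun SZ) (SLZ : cancel SZ LZ).

Definition bits_to (x : Baire) : Z := LZ (decode x).
Definition bits_of (z : Z) : Baire := encode (SZ z).

Lemma bits_ofK : cancel bits_of bits_to.
Proof. by move=> z; rewrite /bits_to encodeK SLZ. Qed.

Lemma borel_bits_to : borel_fun bits_to.
Proof. exact: borel_comp borel_decode (continuous_borel cLZ). Qed.

Lemma borel_bits_of : borel_fun bits_of.
Proof. exact: borel_comp bSZ (continuous_borel continuous_encode). Qed.

Lemma borel_tuple_bits (i : I) : borel [set q | H i (tuple_map bits_to q)].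
Proof.
pose D q := merge (fun n => decode (col n q)).
have bD : borel_fun D.
  apply: borel_baireP.
  apply: (@csimple_merge _ _ (borel_lattice _) (fun n q => decode (col n q))) => n.
   apply: borel_simple; apply: borel_comp borel_decode.
  by apply: continuous_borel; exact: continuous_col.
have -> : [set q | H i (tuple_map bits_to q)] = D @^-1` (tuple_map LZ @^-1` H i).
  rewrite predeqE => q; rewrite /preimage /=.
  suff -> : tuple_map (a := r i) bits_to q = tuple_map LZ (D q) by [].
  by apply/funext => j; rewrite /tuple_map /D col_merge.
by apply: bD; apply: (continuous_borel (continuous_tuple_map cLZ)); exact: borelH.
Qed.

(** * Failure of a coded function to be a homomorphism, as an analytic condition *)

Section Bad.
Variables (W : topologicalType) (rW : retract_baire W).
Variables (K : I -> W -> Baire -> Prop).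
Hypothesis sK : forall i, sigma11 [set p : W * Baire | K i p.1 p.2].
Variables (ec : W -> Baire) (pt : W -> Baire -> Baire).
Hypotheses (c_ec : continuous ec)
           (c_pt : continuous (fun p : W * Baire => pt p.1 p.2)).

(* Some tuple of points, coded by the columns of [q], is related but its image
   under the Borel function coded by [ec w] is not. *)
Definition bad (w : W) : Prop := exists i q, K i w q /\ exists z,
  (forall j : arity_index (r i),
     psi_graph (ec w) (pt w (col (arity_nat j) q)) (col (arity_nat j) z)) /\
  ~ H i (tuple_map bits_to z).

Lemma badP w : fun_code (ec w) -> bad w <-> exists i q, K i w q /\
  ~ H i (fun j => bits_to (psi (ec w) (pt w (col (arity_nat j) q)))).
Proof.
move=> fe; split=> [[i [q [Kq [z [zP nH]]]]]|[i [q [Kq nH]]]]; exists i, q; split=> //.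
  move=> hH; apply: nH; rewrite (_ : tuple_map bits_to z =
    fun j => bits_to (psi (ec w) (pt w (col (arity_nat j) q))))//.
  by apply/funext => j; rewrite /tuple_map; have /(psi_graphP _ _ fe) -> := zP j.
exists (tuple_code (fun j : arity_index (r i) =>
  psi (ec w) (pt w (col (arity_nat j) q)))); split.
  by move=> j; rewrite col_tuple_code; apply/psi_graphP.
move=> hH; apply: nH; move: hH; congr (H i _); apply/funext => j.
by rewrite /tuple_map col_tuple_code.
Qed.

Lemma sigma11_bad : sigma11 bad.
Proof.
have -> : bad = [set w | exists i, exists q, K i w q /\ exists z,
  (forall j : arity_index (r i),
     psi_graph (ec w) (pt w (col (arity_nat j) q)) (col (arity_nat j) z)) /\
  ~ H i (tuple_map bits_to z)] by [].
apply: sigma11_exC => i; apply: sigma11_ex; apply: sigma11I; first exact: sK.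
apply: sigma11_ex; set X : topologicalType := (W * Baire * Baire)%type.
have c1 : continuous (fun p : X => p.1.1).
  by apply: continuous_o; exact: continuous_fst.
have c2 : continuous (fun p : X => p.1.2).
  by apply: continuous_o; [exact: continuous_fst|exact: continuous_snd].
apply: sigma11I; last first.
  apply: borel_sigma11.
    by do 2?apply: retract_baireM => //; exact: retract_baire_id.
  exact: (continuous_borel (@continuous_snd (W * Baire)%type Baire)
    (borelC (borel_tuple_bits i))).
apply: sigma11_all_arity => j.
have c : continuous (fun p : X => ((ec p.1.1, pt p.1.1 (col (arity_nat j) p.1.2)),
    col (arity_nat j) p.2)).
  apply: continuous_pair; last first.
    exact: continuous_o (@continuous_snd _ Baire) (@continuous_col _).
  apply: continuous_pair; first exact: continuous_o c1 c_ec.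
  have c' : continuous (fun p : X => (p.1.1, col (arity_nat j) p.1.2)).
    by apply: continuous_pair => //; exact: continuous_o c2 (@continuous_col _).
  exact: continuous_o c' c_pt.
exact: (sigma11_preimage c sigma11_psi_graph).
Qed.

End Bad.

Section Upper.
Variables (Y : topologicalType) (LY : Baire -> Y) (SY : Y -> Baire).
Hypotheses (cLY : continuous LY) (bSY : borel_fun SY) (SLY : cancel SY LY).
Variables (C : set Baire) (Rel : Baire -> forall i, set (power Y (r i))).
Arguments Rel : clear implicits.
Variable K : I -> Baire -> Baire -> Prop.
Hypothesis sC : sigma11 [set c | ~ C c].
Hypothesis sK : forall i, sigma11 [set p : Baire * Baire | K i p.1 p.2].
Hypothesis KRel : forall c, C c -> forall i q, K i c q <-> Rel c i (tuple_map LY q).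

Lemma sigma12_borel_hom : sigma12 [set c | C c /\
  exists2 phi : Y -> Z, borel_fun phi & forall i p, Rel c i p ->
    H i (fun j => phi (p j))].
Proof.
pose W : topologicalType := (Baire * Baire)%type.
(* The test runs over codes in the range of [SY], those at which the homomorphism
   [bits_to (psi e (SY y))] evaluates [psi e]. *)
pose K' i (w : W) q := K i w.1 q /\
  forall j : arity_index (r i), SY (LY (col (arity_nat j) q)) = col (arity_nat j) q.
pose N := bad K' (snd : W -> Baire) (fun _ q => q).
have sK' i : sigma11 [set p : W * Baire | K' i p.1 p.2].
  apply: sigma11I.
    have c : continuous (fun p : W * Baire => (p.1.1, p.2)).
      apply: continuous_pair; last exact: continuous_snd.
      by apply: continuous_o; exact: continuous_fst.
    exact: (sigma11_preimage c (sK i)).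
  apply: sigma11_all_arity => j; apply: borel_sigma11.
    by do 2?apply: retract_baireM => //; exact: retract_baire_id.
  have c : continuous (fun p : W * Baire => col (arity_nat j) p.2).
    exact: continuous_o (@continuous_snd _ Baire) (@continuous_col _).
  apply: borel_eq_baire; last exact: continuous_borel.
  apply: borel_comp bSY; apply: continuous_borel; exact: continuous_o c cLY.
have sN : sigma11 N.
  apply: sigma11_bad => //.
  - exact: retract_baireM retract_baire_id retract_baire_id.
  - exact: continuous_snd.
  - exact: continuous_snd.
exists [set w : W | [/\ C w.1, fun_code w.2 & ~ N w]].
  rewrite /pi11; have -> : ~` [set w : W | [/\ C w.1, fun_code w.2 & ~ N w]] =
      [set w : W | ~ C w.1 \/ (~ fun_code w.2 \/ N w)].
    rewrite predeqE => w; split=> [nF|[nC|[nf|Nw]] []//].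
    have [Cw|] := pselect (C w.1); last by left.
    have [fw|] := pselect (fun_code w.2); last by right; left.
    by right; right; apply: contrapT => nN; apply: nF.
  apply: sigma11U; first exact: (sigma11_preimage (@continuous_fst Baire Baire) sC).
  apply: sigma11U => //.
  exact: (sigma11_preimage (@continuous_snd Baire Baire) sigma11_not_fun_code).
rewrite predeqE => c; split=> [[Cc [phi bphi hphi]]|[[c' e] /= [Cc fe nN] <-]].
  have [||e fe eE] := @psi_borel (fun x => bits_of (phi (LY x))).
  - apply: (borel_comp (f := fun x => phi (LY x))); last exact: borel_bits_of.
    exact: borel_comp (continuous_borel cLY) bphi.
  - by move=> x m; exact: encode01.
  exists (c, e) => //; split=> //= /(badP _ _ fe)[i [q [[/(KRel Cc) Rq _] nH]]].
  apply: nH; have := hphi i _ Rq; congr (H i _); apply/funext => j.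
  by rewrite eE bits_ofK.
split=> //; exists (fun y => bits_to (psi e (SY y))).
  apply: (borel_comp (f := fun y => psi e (SY y))); last exact: borel_bits_to.
  exact: borel_comp bSY (borel_psi fe).
move=> i p Rp; apply: contrapT => nH; apply: nN; apply/badP => //.
exists i, (tuple_code (SY \o p)); split.
  split=> [|j]; last by rewrite col_tuple_code /= SLY.
  by apply/(KRel Cc); rewrite tuple_map_code.
move=> hH; apply: nH; move: hH; congr (H i _); apply/funext => j.
by rewrite col_tuple_code.
Qed.

End Upper.

End UpperBound.

Section UpperBoundPolish.
Variables (R : realType) (I : countType) (r : I -> arity) (Z : topologicalType).
Variables (polZ : polish R Z) (z0 : Z) (H : structure r Z) (borelH : borel_structure H).
Arguments H : clear implicits.

Lemma sigma12_coded_structures (X : topologicalType) (x0 : X)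
    (U : forall i : I, nat -> set (power X (r i))) :
  polish R X -> (forall i : I, basis (range (U i))) ->
  sigma12 [set c : {ptws I -> Baire} |
    (forall i : I, BC (U i) (c i)) /\
    admits_borel_hom ((fun i => coded (U i) (c i)) : structure r X) H].
Proof.
move=> pX bU; have [LZ [SZ [cLZ bSZ SLZ]]] := polish_param polZ z0.
have [LX [SX [cLX bSX SLX]]] := polish_param pX x0.
pose j (c : {ptws I -> Baire}) : Baire :=
  merge (fun n => if unpickle n is Some i then c i else fun=> 0).
have cj : continuous j.
  apply: continuous_merge => n; case: unpickle => [i|]; first exact: eval_continuous.
  exact: cst_continuous.
have jE c i : col (pickle i) (j c) = c i by rewrite col_merge pickleK.
pose C (c : Baire) := forall i, BC (U i) (col (pickle i) c).
pose Rel (c : Baire) i := coded (U i) (col (pickle i) c).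
pose V i n := tuple_map LX @^-1` U i n.
pose K i c q := evals (V i) true (col (pickle i) c) q.
have bV i n : borel (V i n).
  apply: (continuous_borel (continuous_tuple_map cLX)); apply: open_borel.
  exact: basis_open.
have sC : sigma11 [set c | ~ C c].
  have -> : [set c | ~ C c] = [set c | exists i, ~ BC (U i) (col (pickle i) c)].
    by rewrite predeqE => c /=; rewrite -existsNP.
  apply: sigma11_exC => i.
  exact: (sigma11_preimage (@continuous_col _) (sigma11_notBC (U i))).
have sK i : sigma11 [set p : Baire * Baire | K i p.1 p.2].
  have c : continuous (fun p : Baire * Baire => (col (pickle i) p.1, p.2)).
    apply: continuous_pair; last exact: continuous_snd.
    exact: continuous_o (@continuous_fst _ _) (@continuous_col _).
  exact: (sigma11_preimage c (sigma11_evals true (bV i))).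
have KRel c : C c -> forall i q, K i c q <-> Rel c i (tuple_map LX q).
  move=> Cc i q; apply: iff_trans (coded_preimage (tuple_map LX) q (Cc i)).
  by apply: evalsT; apply/(BC_eq (U i)); exact: Cc.
have := sigma12_preimage cj
  (sigma12_borel_hom borelH cLZ bSZ SLZ cLX bSX SLX sC sK KRel).
congr sigma12; rewrite predeqE => c /=; rewrite /C.
have e : (fun i => col (pickle i) (j c)) = c by apply/funext => i; exact: jE.
split=> -[Cc [phi bphi hphi]].
  split; first by move=> i; rewrite -jE; exact: Cc.
  by exists phi => // i p cp; apply: hphi; rewrite /Rel jE.
split; first by move=> i; rewrite jE; exact: Cc.
by exists phi => // i p; rewrite /Rel jE => cp; exact: hphi.
Qed.

Lemma borel_vertical (G : structure r InfSub) (i : I) : borel_structure G ->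
  borel (vertical Baire G i).
Proof.
move=> bG; apply: borelI.
  apply: borel_all_arity => j; apply: borel_all_arity => k.
  have c l : continuous (fun p : power (Baire * InfSub)%type (r i) => (p l).1).
    apply: continuous_o; [exact: eval_continuous|exact: continuous_fst].
  by apply: borel_eq_baire; exact: continuous_borel.
have c : continuous (fun p : power (Baire * InfSub)%type (r i) =>
    (fun j => (p j).2) : power InfSub (r i)).
  apply: continuous_ptws => j.
  exact: (continuous_o (@eval_continuous _ (Baire * InfSub)%type j)
    (@continuous_snd Baire InfSub)).
exact: (continuous_borel c (bG i)).
Qed.

Lemma sigma12_coded_restrictions (G : structure r InfSub) (borelG : borel_structure G)
    (LY : Baire -> Baire * InfSub) (SY : Baire * InfSub -> Baire)
    (U : nat -> set (Baire * InfSub)%type) :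
  continuous LY -> borel_fun SY -> cancel SY LY -> basis (range U) ->
  sigma12 [set c : Baire | BC U c /\
    admits_borel_hom (restr_structure (coded U c) (vertical Baire G)) H].
Proof.
move=> cLY bSY SLY bU; have [LZ [SZ [cLZ bSZ SLZ]]] := polish_param polZ z0.
pose C := BC U.
pose Rel c i (p : power (Baire * InfSub)%type (r i)) :=
  (forall j, coded U c (p j)) /\ vertical Baire G i p.
pose V n := LY @^-1` U n.
pose K i c q := (forall j : arity_index (r i), evals V true c (col (arity_nat j) q)) /\
  vertical Baire G i (tuple_map LY q).
have bV n : borel (V n).
  by apply: (continuous_borel cLY); apply: open_borel; exact: basis_open.
have sK i : sigma11 [set p : Baire * Baire | K i p.1 p.2].
  apply: sigma11I.
    apply: sigma11_all_arity => j.
    have c : continuous (fun p : Baire * Baire => (p.1, col (arity_nat j) p.2)).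
      apply: continuous_pair; first exact: continuous_fst.
      exact: continuous_o (@continuous_snd _ _) (@continuous_col _).
    exact: (sigma11_preimage c (sigma11_evals true bV)).
  apply: borel_sigma11; first exact: retract_baireM retract_baire_id retract_baire_id.
  have c : continuous (fun p : Baire * Baire =>
      tuple_map LY p.2 : power (Baire * InfSub)%type (r i)).
    exact: continuous_o (@continuous_snd _ _) (continuous_tuple_map cLY).
  exact: (continuous_borel c (borel_vertical (i := i) borelG)).
have KRel c : C c -> forall i q, K i c q <-> Rel c i (tuple_map LY q).
  move=> Cc i q; have E x : evals V true c x <-> coded U c (LY x).
    apply: iff_trans (coded_preimage LY x Cc).
    by apply: evalsT; apply/(BC_eq U).
  by split=> -[Kc Kv]; split=> // j; apply/E; exact: Kc.
have := sigma12_borel_hom borelH cLZ bSZ SLZ cLY bSY SLY (sigma11_notBC U) sK KRel.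
congr sigma12; rewrite predeqE => c /=.
have bc : BC U c -> borel (coded U c).
  move=> Bc; apply: codes_borel (codes_coded Bc) => n.
  by apply: open_borel; exact: basis_open.
split=> -[Cc hom]; split=> //.
  apply/admits_restrP => //; first exact: bc.
  by have [phi bphi hphi] := hom; exists phi => // i p cp vp; exact: hphi.
have /(admits_restrP _ _ z0 (bc Cc))[phi bphi hphi] := hom.
by exists phi => // i p [cp vp]; exact: hphi.
Qed.

End UpperBoundPolish.

(** * Increasing sequences *)

(** Partial sums with each later gap enlarged by one: the result is strictly increasing, dominates
    [x] pointwise, and [x] can be read off from its gaps. *)
Fixpoint incr (x : Baire) (n : nat) : nat :=
  if n is m.+1 then (incr x m + x n).+1 else x 0.

Lemma incr_seq_incr x : incr_seq (incr x).
Proof.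
move=> m n; elim: n => [//|n IH]; rewrite ltnS leq_eqVlt => /orP[/eqP ->|/IH] /=; lia.
Qed.

Lemma leq_incr x n : x n <= incr x n.
Proof. by case: n => [|n] //=; lia. Qed.

Definition to_inf (x : Baire) : InfSub := exist _ (incr x : Baire) (mem_set (@incr_seq_incr x)).

Definition of_inf (y : InfSub) : Baire :=
  fun n => if n is m.+1 then (val y : Baire) n - ((val y : Baire) m).+1
           else (val y : Baire) 0.

Lemma of_infK : cancel of_inf to_inf.
Proof.
move=> y; apply: val_inj; apply/funext => n /=; have inc := set_mem (valP y).
by elim: n => [//|n IH] /=; rewrite IH -addSn subnKC//; exact: inc.
Qed.

Lemma continuous_corestr (S Y : topologicalType) (B : set Y) (f : S -> set_type B) :
  continuous (fun s => val (f s)) -> continuous f.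
Proof.
by move=> /continuousP cf; apply/continuousP => _ [A oA <-]; exact: cf.
Qed.

Lemma continuous_to_inf : continuous to_inf.
Proof.
have lO := open_lattice Baire.
apply: continuous_corestr; apply: continuous_baireP => /=.
have s := continuous_simple (@continuous_id Baire).
elim=> [|n IH]; first exact: (s 0).
exact: (simple_comp lO (fun p : nat * nat => (p.1 + p.2).+1)
  (simple_pair lO IH (s n.+1))).
Qed.

Lemma continuous_inf_val : continuous (fun y : InfSub => val y : Baire).
Proof. exact: initial_continuous. Qed.

Lemma continuous_of_inf : continuous of_inf.
Proof.
have lO := open_lattice InfSub.
have s := continuous_simple continuous_inf_val.
apply: continuous_baireP => -[|n] /=; first exact: (s 0).
exact: (simple_comp lO (fun p : nat * nat => p.1 - p.2.+1)
  (simple_pair lO (s n.+1) (s n))).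
Qed.

Definition to_prod (x : Baire) : Baire * InfSub := (col 0 x, to_inf (col 1 x)).

Definition of_prod (p : Baire * InfSub) : Baire := tup [:: p.1; of_inf p.2].

Lemma of_prodK : cancel of_prod to_prod.
Proof. by move=> [c y]; rewrite /to_prod !col_tup /= of_infK. Qed.

Lemma continuous_to_prod : continuous to_prod.
Proof.
apply: continuous_pair; first exact: continuous_col.
exact: continuous_o (@continuous_col 1) continuous_to_inf.
Qed.

Lemma continuous_of_prod : continuous of_prod.
Proof.
have c : continuous (fun p : Baire * InfSub => (p.1, of_inf p.2)).
  apply: continuous_pair; first exact: continuous_fst.
  exact: continuous_o (@continuous_snd _ _) continuous_of_inf.
exact: continuous_o c continuous_tup2.
Qed.

Lemma infinite_natP (A : set nat) :
  infinite_set A <-> forall N, exists n, N <= n /\ A n.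
Proof.
split=> [iA N|H fA].
  apply: contrapT => nN; apply: iA; apply: (sub_finite_set (B := `I_N)).
    move=> n An /=; rewrite ltnNge; apply/negP => Nn; apply: nN.
    by exists n.
  exact: finite_II.
have [N AN] : exists N, forall n, A n -> n < N.
  have /finite_seqP[s ->] := fA; exists (\max_(i <- s) i).+1 => n ns.
  by rewrite ltnS; exact: leq_bigmax_seq.
by have [n [Nn /AN]] := H N; rewrite ltnNge Nn.
Qed.

Lemma borel_Dom : borel Dom.
Proof.
have -> : Dom = [set p : InfSub * InfSub | forall N, exists n, N <= n /\
    (val p.2 : Baire) n <= (val p.1 : Baire) n].
  by rewrite predeqE => p; split=> /infinite_natP.
have c1 : continuous (fun p : InfSub * InfSub => val p.1 : Baire).
  exact: continuous_o (@continuous_fst _ _) continuous_inf_val.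
have c2 : continuous (fun p : InfSub * InfSub => val p.2 : Baire).
  exact: continuous_o (@continuous_snd _ _) continuous_inf_val.
have lB := borel_lattice (InfSub * InfSub)%type.
have s1 := borel_simple (continuous_borel c1).
have s2 := borel_simple (continuous_borel c2).
apply: borel_all => N; apply: borel_ex => n; apply: borelI; first exact: borel_const.
exact: (simple_pred lB (fun q : nat * nat => q.1 <= q.2)
  (simple_pair lB (s2 n) (s1 n))).
Qed.

Lemma Dom_refl (y : InfSub) : (y, y) \in Dom.
Proof.
by rewrite inE; apply/infinite_natP => N; exists N; split=> //=; exact: leqnn.
Qed.

(** * Bounded branches *)

Section Koenig.
Variables (b : nat -> nat) (P : seq nat -> Prop).

Let ok u := (forall i, i < size u -> nth 0 u i <= b i) /\
            (forall i, i <= size u -> P (take i u)).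

Let ok_take u n : ok u -> ok (take n u).
Proof.
move=> [ub uP]; split=> i; rewrite size_take_min leq_min ?ltn_min.
  by rewrite /= => /andP[iu ilt]; rewrite nth_take//; exact: ub.
by move=> /andP[il iu]; rewrite take_takel//; exact: uP.
Qed.

Let good u := forall n, exists w, size w = n /\ ok (u ++ w).

Let good_rcons u : good u -> exists k, good (rcons u k).
Proof.
move=> gu; apply: contrapT => /forallNP ng.
have /choice[N NP] k : exists n, ~ exists w, size w = n /\ ok (rcons u k ++ w).
  exact/existsNP/ng.
(* Only the entries up to [b (size u)] can come next. If each of them failed at some length [N k], a
   continuation longer than all these lengths would be impossible. *)
pose M := \max_(k < (b (size u)).+1) N k.
have [w' [sw' okw]] := gu M.+1; case: w' sw' okw => [//|k w] [sw] okw.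
have kb : k < (b (size u)).+1.
  have := okw.1 (size u); rewrite size_cat nth_cat ltnn subnn /= ltnS; apply.
  by lia.
apply: (NP k); exists (take (N k) w); split.
  rewrite size_takel// sw; exact: (leq_bigmax (Ordinal kb)).
have := ok_take (size u + (N k).+1) okw.
by rewrite take_cat ltnNge leq_addr /= addKn /= cat_rcons.
Qed.

(** The bound makes the tree finitely branching. A quantifier over reals is thereby traded for
    quantifiers over numbers and finite sequences, which is what makes [dom] Borel. *)
Lemma koenig : (exists t : Baire, (forall n, t n <= b n) /\ forall n, P (mkseq t n)) <->
  forall n, exists u, [/\ size u = n, forall i : nat, i < n -> nth 0 u i <= b i &
    forall i : nat, i <= n -> P (take i u)].
Proof.
split=> [[t [tb tP]] n|H].
  exists (mkseq t n); split; first exact: size_mkseq.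
    by move=> i ilt; rewrite nth_mkseq.
  by move=> i il; rewrite /mkseq -map_take take_iota (minn_idPl il); exact: tP.
have g0 : good [::].
  by move=> n; have [u [su ub uP]] := H n; exists u; split=> //; split; rewrite /= su.
pose X := {u | good u}.
have step (u : X) : {u' : X | exists k, sval u' = rcons (sval u) k}.
  apply: cid; case: u => u gu /=; have [k gk] := good_rcons gu.
  by exists (exist _ (rcons u k) gk); exists k.
have [f [f0 fS]] := dependent_choice step (exist _ [::] g0).
have /choice[t tP] := fS.
have fE n : sval (f n) = mkseq t n.
  by elim: n => [|n IH]; [rewrite f0|rewrite tP IH mkseqS].
have okt n : ok (mkseq t n).
  by have [w [/size0nil -> ]] := svalP (f n) 0; rewrite cats0 fE.
exists t; split=> n.
  by have := (okt n.+1).1 n; rewrite size_mkseq nth_mkseq//; apply.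
by have := (okt n).2 n; rewrite size_mkseq take_oversize ?size_mkseq//; apply.
Qed.

End Koenig.

(* [univ] is universal for closed sets: the code is the zeroth column of [s],
   so that a closed relation may refer to its own code. *)
Definition univ (s t : Baire) : Prop :=
  forall n, col 0 s (pickle (mkseq s n, mkseq t n)) = 0.

(** The shift [M] absorbs finite exceptions: a [t] below [y] from some point on lies below y + M for
    large [M], so a point of [dom s] eventually dominates no [t] with [univ s t]. For fixed [M] the
    candidates [t] form a compact set. *)
Definition dom (s : Baire) (y : InfSub) : Prop := forall M,
  ~ exists t : Baire, (forall n, t n <= (val y : Baire) n + M) /\ univ s t.

Lemma borel_dom : borel [set p : Baire * InfSub | dom p.1 p.2].
Proof.
pose X : topologicalType := (Baire * InfSub)%type.
have lB := borel_lattice X.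
have s1 : csimple (@borel X) fst.
  by apply: borel_simple; apply: continuous_borel; exact: continuous_fst.
have s2 : csimple (@borel X) (fun p => val p.2 : Baire).
  apply: borel_simple; apply: continuous_borel.
  exact: continuous_o (@continuous_snd _ _) continuous_inf_val.
have -> : [set p : X | dom p.1 p.2] = [set p : X | forall M, ~ forall n,
    exists u, size u = n /\ ((forall i : nat, i < n -> nth 0 u i <= (val p.2 : Baire) i + M) /\
    forall i : nat, i <= n -> col 0 p.1 (pickle (mkseq p.1 i, take i u)) = 0)].
  rewrite predeqE => p; split=> H M K; apply: (H M).
    have [|t [tb tP]] := (koenig (fun i => (val p.2 : Baire) i + M)
       (fun u => col 0 p.1 (pickle (mkseq p.1 (size u), u)) = 0)).2.
      move=> n; have [u [su [ub uP]]] := K n; exists u; split=> // i il.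
      by rewrite size_takel ?su//; exact: uP.
    by exists t; split=> // n; have := tP n; rewrite size_mkseq.
  have [t [tb tP]] := K.
  have H' := (koenig (fun i => (val p.2 : Baire) i + M)
       (fun u => col 0 p.1 (pickle (mkseq p.1 (size u), u)) = 0)).1.
  have {}H' := H' (ex_intro _ t (conj tb _)).
  have {}H' := H' (fun n => etrans (congr1 (fun k => col 0 p.1 (pickle (mkseq p.1 k, mkseq t n)))
    (size_mkseq t n)) (tP n)).
  move=> n; have [u [su ub uP]] := H' n; exists u; split=> //; split=> // i il.
  by have := uP i il; rewrite size_takel ?su.
apply: borel_all => M; apply: borelC; apply: borel_all => n; apply: borel_ex => u.
apply: borelI; first exact: borel_const.
apply: borelI; apply: borel_all => i; apply: borel_imply; try exact: borel_const.
  exact: (simple_pred lB (fun k => nth 0 u i <= k + M) (s2 i)).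
apply: (simple_app lB (csimple_col 0 s1)).
exact: (simple_comp lB (fun w => pickle (w, take i u)) (simple_mkseq lB i s1)).
Qed.

(** * Comparison of trees *)

Section Small.
Variables (T : seq nat -> Prop) (S : Baire -> seq nat -> Prop).
Hypothesis T_prefix : forall u k, T (rcons u k) -> T u.
Hypothesis T_wf : ~ exists b : Baire, forall n, T (mkseq b n).
Hypothesis borel_S : forall w, borel [set s | S s w].

Let step (u' u : seq nat) := T u' /\ exists k, u' = rcons u k.

Let accT u : Acc step u.
Proof.
have acc0 : Acc step [::].
  apply: contrapT => n0; apply: T_wf; pose X := {u | ~ Acc step u}.
  have st (v : X) : {u' : X | step (sval u') (sval v)}.
    apply: cid; case: v => v nv /=; apply: contrapT => /forallNP H; apply: nv.
    constructor=> u' uu'; apply: contrapT => nu'; exact: (H (exist _ u' nu')).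
  have [f [f0 fS]] := dependent_choice st (exist _ [::] n0).
  have /choice[b bP] n : exists k, sval (f n.+1) = rcons (sval (f n)) k.
    by have [_] := fS n.
  have fE n : sval (f n) = mkseq b n.
    by elim: n => [|n IH]; [rewrite f0|rewrite bP IH mkseqS].
  exists b => n; have [] := fS n; rewrite bP fE => Tn _; exact: T_prefix Tn.
have accP v : T v -> Acc step v.
  elim/last_ind: v => [//|v k IH] Tv; apply: (Acc_inv (IH (T_prefix Tv))).
  by split=> //; exists k.
by constructor=> u' [Tu' _]; exact: accP.
Qed.

(* [Small u w s]: the rank of [w] in the tree [S s] is below that of [u] in
   [T]. *)
Inductive Small : seq nat -> seq nat -> Baire -> Prop :=
| Small_out u w s : ~ S s w -> Small u w s
| Small_step u w s k :
    T (rcons u k) -> (forall m, Small (rcons u k) (rcons w m) s) -> Small u w s.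

(** The definition descends along [T], which is well-founded and does not depend on [s]. Induction
    along [T] therefore unfolds it into countable unions and intersections, uniformly in [s]. *)
Lemma borel_Small u w : borel [set s | Small u w s].
Proof.
elim: (accT u) w => {}u _ IH w; have -> : [set s | Small u w s] =
    [set s | ~ S s w \/ exists k, T (rcons u k) /\
      forall m, Small (rcons u k) (rcons w m) s].
  rewrite predeqE => s; split=> [|[nS|[k [Tk Sk]]]].
  - by case=> {u w s IH} [u w s|u w s k Tk Sk]; [left|right; exists k].
  - exact: Small_out.
  - exact: Small_step Tk Sk.
apply: borelU; first exact: (borelC (borel_S w)).
apply: borel_ex => k; have [Tk|nTk] := pselect (T (rcons u k)).
  apply: borelI; first exact: borel_const.
  apply: borel_all => m; apply: IH; split=> //; by exists k.
have -> : (fun s => T (rcons u k) /\ forall m, Small (rcons u k) (rcons w m) s) = set0.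
  by rewrite predeqE => s; split=> // -[].
exact: borel0.
Qed.

Lemma Small_no_branch u w s : Small u w s ->
  forall x : Baire, mkseq x (size w) = w -> ~ forall n, S s (mkseq x n).
Proof.
elim=> {u w s} [u w s nS|u w s k Tk _ IH] x xw Sx; apply: contrapT => _.
  by apply: nS; rewrite -xw.
by apply: (IH (x (size w)) x) => //; rewrite size_rcons mkseqS xw.
Qed.

(* The image of the reversed sequence [ru] under a rank-increasing map of [T]
   into [S s]. *)
Fixpoint embed_rev (s : Baire) (ru : seq nat) : seq nat :=
  if ru is k :: ru' then let w := embed_rev s ru' in
    rcons w (least (fun m => ~ Small (rcons (rev ru') k) (rcons w m) s))
  else [::].

Definition embed (s : Baire) : Baire :=
  fun i => if unpickle i is Some u then last 0 (embed_rev s (rev u)) else 0.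

Lemma borel_embed : borel_fun embed.
Proof.
have lB := borel_lattice Baire; apply: borel_baireP => i; rewrite /embed.
case: unpickle => [u|]; last exact: (simple_cst lB).
suff H : simple (@borel Baire) (fun s => embed_rev s (rev u)).
  exact: (simple_comp lB (last 0) H).
elim: (rev u) => [|k ru IH] /=; first exact: (simple_cst lB).
apply: (simple_dep (f := fun s => embed_rev s ru) (g := fun w s => rcons w
  (least (fun m => ~ Small (rcons (rev ru) k) (rcons w m) s))) lB IH) => w.
apply: (simple_comp lB (rcons w)); apply: simple_least => m.
exact: (borelC (borel_Small _ _)).
Qed.

(** [h] supplies only the last entry of the image of each node, so the coded map preserves length
    and order by construction. *)
Definition image_path (h : Baire) (u : seq nat) : seq nat :=
  mkseq (fun i => h (pickle (take i.+1 u))) (size u).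

Lemma image_path_rcons h u k :
  image_path h (rcons u k) = rcons (image_path h u) (h (pickle (rcons u k))).
Proof.
rewrite /image_path size_rcons mkseqS take_oversize ?size_rcons//.
congr rcons; apply: eq_mkseqP => m mu; congr (h (pickle _)).
by rewrite -cats1 takel_cat.
Qed.

(** If [w] is not small against [u], then every child of [u] in [T] has some answer extending [w]
    that is again not small; [embed] takes the least answer. Not being small includes membership in
    [S s]. *)
Lemma embedP s u : ~ Small [::] [::] s -> T u -> S s (image_path (embed s) u).
Proof.
move=> nS Tu; have e v : image_path (embed s) v = embed_rev s (rev v).
  elim/last_ind: v => [//|v k IH]; rewrite image_path_rcons IH.
  by rewrite /embed pickleK rev_rcons /= last_rcons.
suff : ~ Small u (embed_rev s (rev u)) s.
  by rewrite e => ns; apply: contrapT => nSs; apply: ns; exact: Small_out.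
elim/last_ind: u Tu => [//|u k IH] Tk; rewrite rev_rcons /= revK.
apply: (leastP (P := fun m => ~ Small _ (rcons _ m) s)).
apply: contrapT => /forallNP H; apply: (IH (T_prefix Tk)).
by apply: (Small_step Tk) => m; apply: contrapT; exact: H.
Qed.

End Small.

(** * The lower bound *)

Section LowerBound.
Variables (I : countType) (r : I -> arity) (Z : topologicalType).
Variables (H : structure r Z) (borelH : borel_structure H).
Variables (LZ : Baire -> Z) (SZ : Z -> Baire).
Hypotheses (cLZ : continuous LZ) (bSZ : borel_fun SZ) (SLZ : cancel SZ LZ).
Variables (G : structure r InfSub) (borelG : borel_structure G).
Hypothesis nohomG : ~ admits_borel_hom G H.
Arguments H : clear implicits.
Arguments G : clear implicits.
Variables (Phi : set_type Dom -> Z) (borelPhi : borel_fun Phi).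
Hypothesis homPhi : forall x : InfSub,
  homomorphism (restr_structure (Dom_at x) G) H (Dom_sect Phi x).
Variable T : seq nat -> seq nat -> seq nat -> Prop.
Hypothesis T_prefix : forall (x a : Baire) u k,
  T (mkseq x (size u).+1) (mkseq a (size u).+1) (rcons u k) ->
  T (mkseq x (size u)) (mkseq a (size u)) u.

Let related_in (i : I) (s q : Baire) : Prop :=
  G i (tuple_map to_inf q) /\
  forall j : arity_index (r i), dom s (to_inf (col (arity_nat j) q)).

(** [col 2 s] occurs twice: as the code of the function and as the first coordinate of the points at
    which it is evaluated. A code is tested only on the fibre over itself. *)
Let fails_rel := bad H LZ related_in (col 2) (fun s q => tup [:: col 2 s; q]).

(* With [s] coding a triple [(e, v, c)]: [c] does not code a homomorphism on
   the fibre over [c] of the set attached to [e] and [v]. *)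
Let fails (s : Baire) : Prop := ~ fun_code (col 2 s) \/ fails_rel s.

(** This rests on [dom] being Borel jointly in [s] and the point, so that the fibre may depend on an
    arbitrary code of a closed set in column 0. *)
Let sigma11_fails : sigma11 fails.
Proof.
apply: sigma11U.
  exact: (sigma11_preimage (@continuous_col 2) sigma11_not_fun_code).
apply: sigma11_bad => //.
- exact: retract_baire_id.
- move=> i; apply: borel_sigma11.
    exact: retract_baireM retract_baire_id retract_baire_id.
  apply: borelI.
    have c : continuous (fun p : Baire * Baire => tuple_map to_inf p.2 : power InfSub (r i)).
      exact: continuous_o (@continuous_snd _ _) (continuous_tuple_map continuous_to_inf).
    exact: (continuous_borel c (@borelG i)).
  apply: borel_all_arity => j.
  have c : continuous (fun p : Baire * Baire => (p.1, to_inf (col (arity_nat j) p.2))).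
    apply: continuous_pair; first exact: continuous_fst.
    apply: continuous_o continuous_to_inf.
    exact: continuous_o (@continuous_snd _ _) (@continuous_col _).
  exact: (continuous_borel c borel_dom).
- exact: continuous_col.
- have c : continuous (fun p : Baire * Baire => (col 2 p.1, p.2)).
    apply: continuous_pair; last exact: continuous_snd.
    exact: continuous_o (@continuous_fst _ _) (@continuous_col _).
  exact: continuous_o c continuous_tup2.
Qed.

Section Tree.
Variable TN : seq nat -> seq nat -> Prop.
Hypothesis TNP : forall x : Baire, fails x <->
  exists y : Baire, forall n, TN (mkseq x n) (mkseq y n).

(* [t] codes [a] and a map [h] of the tree of [(v, a)] into the tree of
   attempts to witness [fails s]. *)
Let tree_map (s t : Baire) : Prop := forall u : seq nat,
  T (mkseq (col 1 s) (size u)) (mkseq (col 0 t) (size u)) u ->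
  TN (mkseq s (size u)) (image_path (col 1 t) u).

Let closed_tree_map : closed [set p : Baire * Baire | tree_map p.1 p.2].
Proof.
pose W : topologicalType := (Baire * Baire)%type; have lO := open_lattice W.
have s1 : csimple (@open W) fst by apply: continuous_simple; exact: continuous_fst.
have s2 : csimple (@open W) snd by apply: continuous_simple; exact: continuous_snd.
rewrite -openC; have -> : ~` [set p : W | tree_map p.1 p.2] = \bigcup_(u in setT)
    [set p : W | ~ (T (mkseq (col 1 p.1) (size u)) (mkseq (col 0 p.2) (size u)) u ->
     TN (mkseq p.1 (size u)) (image_path (col 1 p.2) u))].
  rewrite predeqE => p; split=> [nt|[u _ nu] tu]; last by apply: nu; exact: tu.
  apply: contrapT => nu; apply: nt => u; apply: contrapT => n; apply: nu.
  by exists u.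
apply: bigcup_open => u _.
have sp : simple (@open W) (fun p => ((mkseq (col 1 p.1) (size u),
    mkseq (col 0 p.2) (size u)), (mkseq p.1 (size u), image_path (col 1 p.2) u))).
  have m k x : csimple (@open W) x -> simple (@open W) (fun p => mkseq (x p) k).
    exact: simple_mkseq.
  apply: (simple_pair lO); apply: (simple_pair lO).
  - by apply: m; exact: csimple_col.
  - by apply: m; exact: csimple_col.
  - exact: m.
  - apply: (m _ (fun p => (fun i => col 1 p.2 (pickle (take i.+1 u))) : Baire)) => i.
    exact: (csimple_col 1 s2).
exact: (simple_pred lO (fun q => ~ (T q.1.1 q.1.2 u -> TN q.2.1 q.2.2)) sp).
Qed.

(** Code of the closed relation [tree_map]. This relation involves [TN], hence [fails] and [dom] for
    all values of [col 0 s]; [e0] is computed from it and only afterwards put into column 0, where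
    [univ] reads it. *)
Let e0 : Baire := fun k => if unpickle k is Some (s, t) then
  if `[< init_tree tree_map s t >] then 0 else 1 else 0.

Let univ_e0 s t : col 0 s = e0 -> univ s t <-> tree_map s t.
Proof.
move=> se; apply: iff_trans (iff_sym (closed_init_tree s t closed_tree_map)).
rewrite /univ se.
by split=> K n; have := K n; rewrite /e0 pickleK; case: asboolP.
Qed.

Let code (v c : Baire) : Baire := tup [:: e0; v; c].

Let continuous_code (W : topologicalType) (f g : W -> Baire) :
  continuous f -> continuous g -> continuous (fun w => code (f w) (g w)).
Proof.
move=> cf cg; have := @continuous_merge W
  (fun n w => nth (fun=> 0) [:: e0; f w; g w] n).
apply; case=> [|[|[|n]]] //=; first exact: cst_continuous.
by rewrite nth_nil; exact: cst_continuous.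
Qed.

Let fibers : set (Baire * (Baire * InfSub))%type :=
  [set p | dom (code p.1 p.2.1) p.2.2].

Let borel_fibers : borel fibers.
Proof.
have c : continuous (fun p : Baire * (Baire * InfSub) => (code p.1 p.2.1, p.2.2)).
  apply: continuous_pair.
    apply: continuous_code; first exact: continuous_fst.
    by apply: continuous_o; [exact: continuous_snd|exact: continuous_fst].
  by apply: continuous_o; exact: continuous_snd.
exact: (continuous_borel c borel_dom).
Qed.

Let hom_on (v : Baire) (phi : Baire * InfSub -> Z) : Prop :=
  forall i (p : power (Baire * InfSub)%type (r i)),
    (forall j, fibers (v, p j)) -> vertical Baire G i p -> H i (fun j => phi (p j)).

Let not_failsP s : ~ fails s -> fun_code (col 2 s) /\ forall i q, related_in i s q ->
  H i (fun j => bits_to LZ (psi (col 2 s) (tup [:: col 2 s; col (arity_nat j) q]))).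
Proof.
move=> nf; have fc : fun_code (col 2 s).
  by apply: contrapT => nc; apply: nf; left.
split=> // i q rq; apply: contrapT => nH; apply: nf; right.
by apply/badP => //; exists i, q.
Qed.

Let no_hom v : (forall a : Baire, exists b : Baire, forall n,
    T (mkseq v n) (mkseq a n) (mkseq b n)) ->
  ~ exists2 phi, borel_fun phi & hom_on v phi.
Proof.
move=> vB [phi bphi hphi].
have [||c fc cE] := @psi_borel (fun x => bits_of SZ (phi (to_prod x))).
- apply: (borel_comp (f := fun x => phi (to_prod x))); last exact: borel_bits_of.
  exact: borel_comp (continuous_borel continuous_to_prod) bphi.
- by move=> x m; exact: encode01.
have cc : col 2 (code v c) = c by rewrite col_tup.
have nf : ~ fails (code v c).
  move=> [|]; first by rewrite cc.
  move=> /badP; rewrite cc => /(_ fc)[i [q [[Gq dq] nH]]]; apply: nH.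
  have : H i (fun j => phi (c, to_inf (col (arity_nat j) q))).
    by apply: (hphi i (fun j => (c, to_inf (col (arity_nat j) q)))).
  congr (H i _); apply/funext => j.
  by rewrite cE bits_ofK// /to_prod !col_tup.
have nt t : ~ univ (code v c) t.
  move=> /univ_e0 => /(_ (col_tup 0 _)) tm; apply: nf; apply/TNP.
  have [b bP] := vB (col 0 t).
  (* The image of the branch [b] under the coded map. *)
  exists (fun n => col 1 t (pickle (mkseq b n.+1))) => n.
  have := tm (mkseq b n); rewrite size_mkseq col_tup => /(_ (bP n)).
  rewrite /image_path size_mkseq; congr TN; apply: eq_mkseqP => m mn.
  congr (col 1 t (pickle _)); rewrite /mkseq -map_take take_iota.
  by rewrite (minn_idPl mn).
apply: nohomG; exists (fun y => phi (c, y)).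
  apply: (borel_comp (f := fun y : InfSub => (c, y))) bphi.
  apply: continuous_borel; apply: continuous_pair; first exact: cst_continuous.
  exact: continuous_id.
move=> i y Gy; apply: (hphi i (fun j => (c, y j))) => // j M [t [_ ut]].
exact: (nt t ut).
Qed.

(** * A homomorphism obtained from a well-founded tree *)

Section Witness.
Variables (v a : Baire).
Hypothesis aP : ~ exists b : Baire, forall n, T (mkseq v n) (mkseq a n) (mkseq b n).

Let Ta (u : seq nat) := T (mkseq v (size u)) (mkseq a (size u)) u.
Let SN (s : Baire) (w : seq nat) := TN (mkseq s (size w)) w.

Let Ta_prefix u k : Ta (rcons u k) -> Ta u.
Proof. by rewrite /Ta size_rcons; exact: T_prefix. Qed.

Let Ta_wf : ~ exists b : Baire, forall n, Ta (mkseq b n).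
Proof.
by move=> [b bP]; apply: aP; exists b => n; have := bP n; rewrite /Ta size_mkseq.
Qed.

Let borel_SN w : borel [set s | SN s w].
Proof.
have lB := borel_lattice Baire.
have s : csimple (@borel Baire) id.
  by apply: borel_simple; apply: continuous_borel; exact: continuous_id.
exact: (simple_pred lB (fun q => TN q w) (simple_mkseq lB (size w) s)).
Qed.

Let small c := Small Ta SN [::] [::] (code v c).

Let continuous_code1 : continuous (code v).
Proof. by apply: continuous_code; [exact: cst_continuous|exact: continuous_id]. Qed.

Let borel_small : borel small.
Proof.
exact: (continuous_borel continuous_code1 (borel_Small Ta_prefix Ta_wf borel_SN [::] [::])).
Qed.

Let small_not_fails c : small c -> ~ fails (code v c).
Proof.
move=> sc /TNP[y yP]; apply: (Small_no_branch sc (x := y)) => // n.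
by rewrite /SN size_mkseq.
Qed.

Let bound c : Baire := tup [:: a; embed Ta SN (code v c)].

Let bound_univ c : ~ small c -> univ (code v c) (bound c).
Proof.
move=> nc; apply/univ_e0; first by rewrite col_tup.
move=> u; rewrite !col_tup /= => Tu; have := embedP Ta_prefix nc Tu.
by rewrite /SN /image_path size_mkseq.
Qed.

Let bound_dom c y : ~ small c -> dom (code v c) y -> le_infty y (to_inf (bound c)).
Proof.
move=> nc dy; apply/infinite_natP => N; apply: contrapT => nN.
(* Beyond [N] the point [y] exceeds [bound c]; below [N] the sum of the finitely many values of
   [bound c] dominates each of them, so it serves as the shift. *)
apply: (dy (\sum_(i < N) bound c i)); exists (bound c).
split; last exact: bound_univ.
move=> n; have [nN'|Nn] := ltnP n N.
  apply: leq_trans (leq_addl _ _).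
  by rewrite (bigD1 (Ordinal nN')) //= leq_addr.
apply: leq_trans (leq_addr _ _); apply: ltnW; rewrite ltnNge; apply/negP => yn.
by apply: nN; exists n; split=> //; exact: leq_trans yn (leq_incr _ _).
Qed.

Let borel_bound : borel_fun bound.
Proof.
have lB := borel_lattice Baire.
have bE : borel_fun (fun c => embed Ta SN (code v c)).
  exact: borel_comp (continuous_borel continuous_code1)
    (borel_embed Ta_prefix Ta_wf borel_SN).
apply: borel_baireP; apply: (@csimple_merge _ _ lB
  (fun n c => nth (fun=> 0) [:: a; embed Ta SN (code v c)] n)) => -[|[|n]] /=.
- by move=> m; exact: simple_cst.
- exact: borel_simple.
- by rewrite nth_nil => m; exact: simple_cst.
Qed.

(* On the Borel set [small], whose members are codes, evaluation of codes is
   Borel by Lusin separation. *)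
Let borel_eval : exists2 f : Baire -> Baire, borel_fun f &
  forall x, small (col 0 x) -> f x = psi (col 0 x) x.
Proof.
have bb n : borel (baire_basis n).
  by apply: open_borel; exact: basis_open basis_baire.
(* Membership in [small] guarantees that the columns are codes, and only then are the two analytic
   sets disjoint. *)
have sE b m : sigma11 [set x | small (col 0 x) /\ evals baire_basis b (col m (col 0 x)) x].
  apply: sigma11I.
    by apply: baire_borel_sigma11; exact: (continuous_borel (@continuous_col 0) borel_small).
  have c : continuous (fun x => (col m (col 0 x), x)).
    apply: continuous_pair; last exact: continuous_id.
    exact: continuous_o (@continuous_col 0) (@continuous_col m).
  exact: (sigma11_preimage c (sigma11_evals b bb)).
have fc c : small c -> fun_code c.
  by move=> /small_not_fails/not_failsP[]; rewrite col_tup.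
have /choice[C CP] m : exists C : set Baire, borel C /\
    forall x, small (col 0 x) -> C x <-> coded baire_basis (col m (col 0 x)) x.
  have [|C [bC CT CF]] := sigma11_separation (sE true m) (sE false m).
    by move=> x [sx /(evalsT _ (fc _ sx m)) cx] [_ /(evalsF _ (fc _ sx m))].
  exists C; split=> // x sx; split=> [Cx|cx].
    apply: contrapT => ncx; apply: (CF x) Cx; split=> //.
    by apply/evalsF => //; exact: fc.
  by apply: CT; split=> //; apply/evalsT => //; exact: fc.
exists (fun x m => if `[< C m x >] then 1 else 0).
  apply: borel_baireP => m k; have [bC _] := CP m.
  have lB := borel_lattice Baire.
  have sb : simple (@borel Baire) (fun x => `[< C m x >]).
    move=> [|]; first by rewrite (_ : [set x | _] = C m)// predeqE => x; split=> /asboolP.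
    rewrite (_ : [set x | _] = ~` C m); first exact: borelC.
    by rewrite predeqE => x; rewrite /setC /=; case: asboolP.
  exact: (simple_comp lB (fun b : bool => if b then 1 else 0) sb k).
move=> x sx; apply/funext => m; rewrite /psi; congr (if _ then _ else _).
by apply/asbool_equiv_eq; have [_] := CP m; exact.
Qed.

Lemma witness_hom : exists2 phi, borel_fun phi & hom_on v phi.
Proof.
have [f bf fE] := borel_eval.
pose y0 := to_inf (fun=> 0).
pose z0 : Z := Phi (exist (fun p => p \in Dom) (y0, y0) (Dom_refl y0)).
have [Phi' bPhi' Phi'E] := borel_extend z0 borel_Dom borelPhi.
pose g (p : Baire * InfSub) := tup [:: bound p.1; of_inf p.2].
have bg : borel_fun g.
  have lB := borel_lattice (Baire * InfSub)%type.
  apply: borel_baireP; apply: (@csimple_merge _ _ lB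
    (fun n (p : Baire * InfSub) => nth (fun=> 0) [:: bound p.1; of_inf p.2] n)) => -[|[|n]] /=.
  - apply: borel_simple.
    exact: borel_comp (continuous_borel (@continuous_fst _ _)) borel_bound.
  - apply: borel_simple; apply: continuous_borel.
    exact: continuous_o (@continuous_snd _ _) continuous_of_inf.
  - by rewrite nth_nil => m; exact: simple_cst.
pose k (x : Baire) := (to_inf (col 0 x), to_inf (col 1 x)).
have ck : continuous k.
  apply: continuous_pair.
    exact: continuous_o (@continuous_col 0) continuous_to_inf.
  exact: continuous_o (@continuous_col 1) continuous_to_inf.
exists (fun p => if `[< small p.1 >] then bits_to LZ (f (of_prod p)) else Phi' (k (g p))).
  apply: (borel_if (B := [set p : Baire * InfSub | small p.1])).
  - exact: (continuous_borel (@continuous_fst Baire InfSub) borel_small).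
  - apply: (borel_comp (f := fun p => f (of_prod p))); last exact: borel_bits_to.
    exact: borel_comp (continuous_borel continuous_of_prod) bf.
  - apply: (borel_comp (f := fun p => k (g p))) => //.
    exact: borel_comp bg (continuous_borel ck).
move=> i p dp [p1 Gp].
(* A tuple of arity 0 determines no fibre; any [c] will do for it. *)
have [c pc] : exists c, forall j, (p j).1 = c.
  have [[j _]|nj] := pselect (exists j : arity_index (r i), True).
    by exists (p j).1 => k'; exact: p1.
  by exists (fun=> 0) => j; case: nj; exists j.
have {}dp j : dom (code v c) (p j).2 by have := dp j; rewrite /fibers /= pc.
have [sc|nsc] := pselect (small c).
  have [_ Hc] := not_failsP (small_not_fails sc).
  have /Hc : related_in i (code v c) (tuple_code (of_inf \o (fun j => (p j).2))).
    split; first by rewrite (tuple_map_code _ of_infK).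
    by move=> j; rewrite col_tuple_code /= of_infK; exact: dp.
  congr (H i _); apply/funext => j; rewrite pc; case: asboolP => // _.
  rewrite col_tuple_code !col_tup /= fE; last by rewrite col_tup /= pc.
  by rewrite /of_prod pc col_tup.
pose x := to_inf (bound c).
have Dx j : Dom_at x (p j).2 by exact: bound_dom.
have := @homPhi x i (fun j => exist _ (p j).2 (mem_set (Dx j))) Gp.
congr (H i _); apply/funext => j; rewrite pc; case: asboolP => // _.
rewrite /Dom_sect -Phi'E /=; congr Phi'.
by rewrite /k /g pc !col_tup /= of_infK.
Qed.

End Witness.

Lemma borel_fibers_hom_tree : exists2 D : set (Baire * (Baire * InfSub))%type, borel D &
  forall v : Baire, (exists a : Baire, ~ exists b : Baire, forall n,
      T (mkseq v n) (mkseq a n) (mkseq b n)) <->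
    exists2 phi : Baire * InfSub -> Z, borel_fun phi &
      forall i (p : power (Baire * InfSub)%type (r i)),
        (forall j, D (v, p j)) -> vertical Baire G i p -> H i (fun j => phi (p j)).
Proof.
exists fibers => [|v]; first exact: borel_fibers.
split=> [[a aP]|hom]; first exact: witness_hom aP.
apply: contrapT => nB; apply: no_hom hom => a; apply: contrapT => nb.
by apply: nB; exists a.
Qed.

End Tree.

Lemma borel_fibers_hom : exists2 D : set (Baire * (Baire * InfSub))%type, borel D &
  forall v : Baire, (exists a : Baire, ~ exists b : Baire, forall n,
      T (mkseq v n) (mkseq a n) (mkseq b n)) <->
    exists2 phi : Baire * InfSub -> Z, borel_fun phi &
      forall i (p : power (Baire * InfSub)%type (r i)),
        (forall j, D (v, p j)) -> vertical Baire G i p -> H i (fun j => phi (p j)).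
Proof.
have [TN TNP] := sigma11_tree sigma11_fails.
exact: borel_fibers_hom_tree TNP.
Qed.

End LowerBound.

(** * Hardness *)

Lemma uncountable_inhabited (X : Type) : ~ countable [set: X] -> exists x : X, True.
Proof.
move=> ncX; apply: contrapT => nX; apply: ncX.
by rewrite (_ : setT = set0) ?predeqE// => x; split=> // _; apply: nX; exists x.
Qed.

Section Hardness.
Variables (R : realType) (I : countType) (r : I -> arity) (Z : topologicalType).
Variables (polZ : polish R Z) (H : structure r Z) (borelH : borel_structure H).
Variables (G : structure r InfSub) (borelG : borel_structure G).
Hypothesis nohomG : ~ admits_borel_hom G H.
Arguments H : clear implicits.
Arguments G : clear implicits.
Variables (Phi : set_type Dom -> Z) (borelPhi : borel_fun Phi).
Hypothesis homPhi : forall x : InfSub,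
  homomorphism (restr_structure (Dom_at x) G) H (Dom_sect Phi x).

Definition some_value : Z :=
  Phi (exist (fun p => p \in Dom) (to_inf (fun=> 0), to_inf (fun=> 0))
         (Dom_refl (to_inf (fun=> 0)))).

Lemma sigma12_fibers (V : topologicalType) (B : set V) :
  polish R V -> zero_dim V -> sigma12 B ->
  exists j : V -> Baire, exists D : set (Baire * (Baire * InfSub))%type,
    [/\ continuous j, borel D & forall v, B v <->
      exists2 phi : Baire * InfSub -> Z, borel_fun phi &
        forall i (p : power (Baire * InfSub)%type (r i)),
          (forall j', D (j v, p j')) -> vertical Baire G i p ->
          H i (fun j' => phi (p j'))].
Proof.
move=> pV zV sB; have [j [T [cj T_prefix BT]]] := sigma12_tree pV zV sB.
have [LZ [SZ [cLZ bSZ SLZ]]] := polish_param polZ some_value.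
have [D bD DP] := borel_fibers_hom borelH cLZ bSZ SLZ borelG nohomG borelPhi
  homPhi T_prefix.
by exists j, D; split=> // v; apply: iff_trans (BT v) _; exact: DP.
Qed.

Lemma restrictions_hard (U : nat -> set (Baire * InfSub)%type) :
  basis (range U) ->
  sigma12_hard R [set c : Baire | BC U c /\
    admits_borel_hom (restr_structure (coded U c) (vertical Baire G)) H].
Proof.
move=> bU V pV zV B sB; have [j [D [cj bD BD]]] := sigma12_fibers pV zV sB.
have [f cf fP] := borel_section_codes bU bD.
exists (f \o j); first exact: continuous_o cj cf.
rewrite predeqE => v; rewrite /preimage /=.
have cE := coded_codes (fP (j v)).
have bS : borel (coded U (f (j v))).
  apply: (codes_borel _ (codes_coded _)); last by exists [set w | D (j v, w)].
  by move=> n; apply: open_borel; exact: basis_open.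
have E := admits_restrP (vertical Baire G) H some_value bS.
apply: (iff_trans (BD v)); split.
  move=> [phi bphi hphi]; split; first by exists [set w | D (j v, w)].
  by apply/E; exists phi => // i p; rewrite cE; exact: hphi.
by move=> [_ /E[phi bphi hphi]]; exists phi => // i p Dp; apply: hphi; rewrite cE.
Qed.

(** [Rel] is the full preimage of the restricted structure under the Borel map [to_prod \o S] from
    [X], with right inverse [emb \o encode \o of_prod]. Both maps are Borel homomorphisms between
    the two structures, so a homomorphism to [H] from either one gives one from the other. *)
Lemma structures_hard (X : topologicalType) : polish R X -> ~ countable [set: X] ->
  forall U : forall i : I, nat -> set (power X (r i)),
  (forall i : I, basis (range (U i))) ->
  sigma12_hard R [set c : {ptws I -> Baire} | (forall i : I, BC (U i) (c i)) /\
    admits_borel_hom ((fun i => coded (U i) (c i)) : structure r X) H].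
Proof.
move=> pX ncX U bU V pV zV B sB.
have [x0 _] := uncountable_inhabited ncX.
have [j [D [cj bD BD]]] := sigma12_fibers pV zV sB.
have [emb [ret [c_emb b_ret embK]]] := polish_perfect pX x0 ncX.
pose S x := decode (ret x).
have bS : borel_fun S by exact: borel_comp b_ret borel_decode.
have SK p : to_prod (S (emb (encode (of_prod p)))) = p.
  rewrite /S embK ?encodeK ?of_prodK// => n; exact: encode01.
pose Rel (i : I) : set (Baire * power X (r i))%type := [set w |
  (forall k, D (w.1, to_prod (S (w.2 k)))) /\
  vertical Baire G i (fun k => to_prod (S (w.2 k)))].
have bRel i : borel (Rel i).
  have cq : continuous (fun w : Baire * power X (r i) => w.2).
    exact: continuous_snd.
  apply: borelI.
    apply: borel_all_arity => k.
    pose h (w : Baire * power X (r i)) := tup [:: w.1; S (w.2 k)].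
    have bh : borel_fun h.
      have lB := borel_lattice (Baire * power X (r i))%type.
      apply: borel_baireP; apply: (@csimple_merge _ _ lB
        (fun n (w : Baire * power X (r i)) => nth (fun=> 0) [:: w.1; S (w.2 k)] n)) => -[|[|n]] /=.
      - by apply: borel_simple; apply: continuous_borel; exact: continuous_fst.
      - apply: borel_simple; apply: borel_comp bS; apply: continuous_borel.
        exact: continuous_o cq (@eval_continuous _ X k).
      - by rewrite nth_nil => m; exact: simple_cst.
    have c : continuous (fun x => (col 0 x, to_prod (col 1 x))).
      apply: continuous_pair; first exact: continuous_col.
      exact: continuous_o (@continuous_col 1) continuous_to_prod.
    have := bh _ (continuous_borel c bD); congr borel; rewrite predeqE => w.
    by rewrite /preimage /= /h !col_tup.
  have := borel_tuple_code cq bS (continuous_borel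
    (continuous_tuple_map (a := r i) continuous_to_prod) (borel_vertical (i := i) borelG)).
  congr borel; rewrite predeqE => w; rewrite /preimage /=.
  suff -> : tuple_map to_prod (tuple_code (S \o w.2)) =
    (fun k => to_prod (S (w.2 k))) :> power (Baire * InfSub)%type (r i) by [].
  by apply/funext => k; rewrite /tuple_map col_tuple_code.
have /choice[f fP] i : exists f : Baire -> Baire, continuous f /\
    forall v, codes (U i) (f v) [set p | Rel i (v, p)].
  by have [f] := borel_section_codes (bU i) (bRel i); exists f.
exists (fun v => (fun i => f i (j v)) : {ptws I -> Baire}).
  by apply: continuous_ptws => i; exact: continuous_o cj (fP i).1.
rewrite predeqE => v; rewrite /preimage /=.
have cE i : coded (U i) (f i (j v)) = [set p | Rel i (j v, p)].
  exact: coded_codes ((fP i).2 (j v)).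
apply: (iff_trans (BD v)); split=> [[phi bphi hphi]|[_ [phi bphi hphi]]].
  split; first by move=> i; exists [set p | Rel i (j v, p)]; exact: (fP i).2.
  exists (fun x => phi (to_prod (S x))).
    apply: (borel_comp (f := fun x => to_prod (S x))) bphi.
    exact: borel_comp bS (continuous_borel continuous_to_prod).
  by move=> i p; rewrite cE => -[Dp vp]; exact: (hphi i (fun k => to_prod (S (p k)))).
exists (fun p => phi (emb (encode (of_prod p)))).
  apply: (borel_comp (f := fun p => emb (encode (of_prod p)))) bphi.
  apply: continuous_borel; apply: continuous_o c_emb.
  exact: continuous_o continuous_of_prod continuous_encode.
move=> i p Dp vp; apply: (hphi i (fun k => emb (encode (of_prod (p k))))).
rewrite cE /Rel /=; split=> [k|]; first by rewrite SK; exact: Dp.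
by rewrite (_ : (fun k => _) = p)//; apply/funext => k; rewrite SK.
Qed.

End Hardness.

Theorem theorem3p1 (R : realType) (I : countType) (r : I -> arity)
    (Z : topologicalType) (polZ : polish R Z)
    (H : structure r Z) (borelH : borel_structure H)
    (G : structure r InfSub) (borelG : borel_structure G)
    (nohomG : ~ admits_borel_hom G H)
    (Phi : set_type Dom -> Z) (borelPhi : borel_fun Phi)
    (homPhi : forall x : InfSub,
       homomorphism (restr_structure (Dom_at x) G) H (Dom_sect Phi x)) :
  (forall X : topologicalType, polish R X -> ~ countable [set: X] ->
   forall U : forall i : I, nat -> set (power X (r i)),
   (forall i : I, basis (range (U i))) ->
   sigma12_complete R
     [set c : {ptws I -> Baire} |
        (forall i : I, BC (U i) (c i)) /\
        admits_borel_hom ((fun i => coded (U i) (c i)) : structure r X) H])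
  /\
  (forall U : nat -> set (Baire * InfSub)%type,
   basis (range U) ->
   sigma12_complete R
     [set c : Baire |
        BC U c /\
        admits_borel_hom
          (restr_structure (coded U c) (vertical Baire G)) H]).
Proof.
split=> [X pX ncX U bU|U bU]; split.
- have [x0 _] := uncountable_inhabited ncX.
  exact: (sigma12_coded_structures polZ (some_value Phi)).
- exact: (structures_hard polZ borelH borelG nohomG borelPhi homPhi).
- exact: (sigma12_coded_restrictions polZ (some_value Phi) borelH borelG
    continuous_to_prod (continuous_borel continuous_of_prod) of_prodK).
- exact: (restrictions_hard polZ borelH borelG nohomG borelPhi homPhi).
Qed.
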